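(* Let $\mathcal{P}$ be a polynomial functor of degree $d$. (1) For a fixed $j$, the groups $H^j\left(\mathbb{P}^{n-1},\mathcal{P}(\Omega)\right)$ are independent of $n$ (up to isomorphism) as long as $j<n-1$. (2) The groups $H^j\left(\mathbb{P}^{n-1},\mathcal{P}(\Omega)\right)$ are independent of $n$ (up to isomorphism) as long as $d\leq n-1$. (3) We have $H^j\left(\mathbb{P}^{n-1},\mathcal{P}(\Omega)\right)=0$ for $j>d$.
   Context: $\mathbf{k}$ is an algebraically closed field. A polynomial functor of degree $d$ is a functor $\mathcal{P}$ from finite dimensional $\mathbf{k}$-vector spaces to itself such that the maps $\operatorname{Hom}(V,W)\to\operatorname{Hom}(\mathcal{P}(V),\mathcal{P}(W))$ are polynomial and $\mathcal{P}(c\cdot\mathrm{id}_V)=c^d\cdot\mathrm{id}_{\mathcal{P}(V)}$ for all $c\in\mathbf{k}$. Such functors apply to vector bundles. $\Omega$ denotes the cotangent sheaf of the projective space $\mathbb{P}^{n-1}$ over $\mathbf{k}$ under consideration. *)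

(* Defs.v *)
(* Conventions.

   A vector bundle of rank r on the projective space P^(n-1), with homogeneous
   coordinates x_0, ..., x_(n-1), is given by its transition matrices
   g i j : U_i :&: U_j -> GL_r on the standard charts U_i = {x_i != 0}, and a
   polynomial functor P is applied to it by applying P to the fibres and to the
   transition maps.  Since k is algebraically closed, regular functions are
   functions on k-points; they are represented as functions of the homogeneous
   coordinates x, with value 0 outside of the open set under consideration.

   The cohomology of the coherent sheaf P(E) is defined by the (alternating)
   Cech complex of the affine cover (U_i)_i, whose intersections are affine. *)
From HB Require Import structures.
From mathcomp Require Import all_boot all_algebra.
From mathcomp Require Import boolp functions mpoly ring.

Set Implicit Arguments.
Unset Strict Implicit.
Unset Printing Implicit Defensive.

Import GRing.Theory.
Local Open Scope ring_scope.
Local Open Scope quotient_scope.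

(* Polynomiality does not depend on the choice of the bases. *)
Definition polynomial_map (k : fieldType) (U W : vectType k) (f : U -> W) :=
  forall l : 'I_(\dim {:W}), exists q : {mpoly k[\dim {:U}]},
    forall u : U,
      coord (vbasis {:W}) l (f u) = q.@[fun i => coord (vbasis {:U}) i u].

Record polyFunctor (k : fieldType) := PolyFunctor {
  pf_obj :> vectType k -> vectType k;
  pf_map : forall U W : vectType k, 'Hom(U, W) -> 'Hom(pf_obj U, pf_obj W);
  pf_map_id : forall U : vectType k, pf_map (\1%VF : 'End(U)) = \1%VF;
  pf_map_comp : forall (U V W : vectType k) (f : 'Hom(V, W)) (g : 'Hom(U, V)),
    pf_map (f \o g)%VF = (pf_map f \o pf_map g)%VF;
  pf_map_poly : forall U W : vectType k, polynomial_map (@pf_map U W) }.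

Definition of_degree (k : fieldType) (d : nat) (P : polyFunctor k) :=
  forall (V : vectType k) (c : k),
    pf_map P (c *: \1%VF : 'End(V)) = c ^+ d *: \1%VF.

Section LmodQuotient.
Variables (R : nzRingType) (V : lmodType R) (S : submodClosed V).

(* submodClosed does not inherit from zmodClosed, as needed for quotients. *)
Definition submod_pred : {pred V} := S.
Lemma submod_pred_closed : GRing.subsemimod_closed submod_pred.
Proof. by split; [split; [exact: rpred0|exact: rpredD]|exact: rpredZ]. Qed.
HB.instance Definition _ :=
  GRing.isSubmodClosed.Build R V submod_pred submod_pred_closed.

Definition lquot := Quotient.quot submod_pred.
HB.instance Definition _ := GRing.Zmodule.on lquot.

Definition lquot_pi (v : V) : lquot := \pi_(Quotient.quot submod_pred) v.
Definition lquot_scale (a : R) (x : lquot) : lquot := lquot_pi (a *: repr x).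

Lemma lquot_eqP (u v : V) : reflect (lquot_pi u = lquot_pi v) (u - v \in S).
Proof. by rewrite -[_ \in S]/(_ \in submod_pred) Quotient.idealrBE; exact: eqP. Qed.

Lemma lquot_reprK (x : lquot) : lquot_pi (repr x) = x.
Proof. exact: reprK. Qed.

Lemma lquot_piD (u v : V) : lquot_pi (u + v) = lquot_pi u + lquot_pi v.
Proof. exact: Quotient.pi_add. Qed.

Lemma lquot_piZ (a : R) (v : V) : lquot_pi (a *: v) = lquot_scale a (lquot_pi v).
Proof.
apply/lquot_eqP; rewrite -scalerBr rpredZ//.
by apply/lquot_eqP; rewrite lquot_reprK.
Qed.

Lemma lquot_scaleA a b x :
  lquot_scale a (lquot_scale b x) = lquot_scale (a * b) x.
Proof. by rewrite -(lquot_reprK x) -!lquot_piZ scalerA. Qed.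

Lemma lquot_scale1 : left_id 1 lquot_scale.
Proof. by move=> x; rewrite -(lquot_reprK x) -lquot_piZ scale1r. Qed.

Lemma lquot_scaleDr : right_distributive lquot_scale +%R.
Proof.
move=> a x y; rewrite -(lquot_reprK x) -(lquot_reprK y).
by rewrite -lquot_piD -!lquot_piZ -lquot_piD scalerDr.
Qed.

Lemma lquot_scaleDl x : {morph lquot_scale^~ x : a b / a + b}.
Proof.
by move=> a b; rewrite -(lquot_reprK x) -!lquot_piZ scalerDl lquot_piD.
Qed.

HB.instance Definition _ := GRing.Zmodule_isLmodule.Build R lquot
  lquot_scaleA lquot_scale1 lquot_scaleDr lquot_scaleDl.

End LmodQuotient.

Lemma asbool_submod_closed (R : nzRingType) (V : lmodType R) (Q : V -> Prop) :
    Q 0 -> (forall a u v, Q u -> Q v -> Q (a *: u + v)) ->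
  GRing.subsemimod_closed (fun v => `[< Q v >]).
Proof.
move=> Q0 QD; split; first split=> [|u v].
- exact/asboolP.
- by move=> /asboolP Qu /asboolP Qv; apply/asboolP; rewrite -[u]scale1r; exact: QD.
- move=> a u /asboolP Qu; apply/asboolP; rewrite -[_ *: _]addr0; exact: QD.
Qed.

(* The subquotient Z / (Z :&: B) of an R-module *)
Section SubQuotient.
Variables (R : nzRingType) (V : lmodType R) (Z B : submodClosed V).

Definition submod := {v : V | v \in submod_pred Z}.
HB.instance Definition _ := SubChoice.on submod.
HB.instance Definition _ := [SubChoice_isSubLmodule of submod by <:].

Definition submod_in : {pred submod} := fun v => val v \in B.

Lemma submod_in_closed : GRing.subsemimod_closed submod_in.
Proof.
have inE v : (v \in submod_in) = (val v \in B) by [].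
split; first split=> [|u v]; rewrite ?inE.
- by rewrite (raddf0 (val : submod -> V)) rpred0.
- by rewrite (raddfD (val : submod -> V)); exact: rpredD.
- by move=> a v; rewrite !inE => Bv; rewrite [val _](_ : _ = a *: val v) ?rpredZ.
Qed.
HB.instance Definition _ :=
  GRing.isSubmodClosed.Build R submod submod_in submod_in_closed.

Definition subquot : lmodType R := lquot submod_in.

End SubQuotient.

Section Projective.
Variables (k : fieldType) (n : nat).
Implicit Types (I : {set 'I_n}) (x : 'rV[k]_n).

(* x lies in the intersection U_I of the charts U_i for i in I *)
Definition in_chart I x : bool := [forall i in I, x 0 i != 0].

(* Elements of the coordinate ring of U_I, the degree 0 part of the localization
   of k[x_0, ..., x_(n-1)] at the product of the x_i for i in I *)
Definition regular I (f : 'rV[k]_n -> k) : Prop :=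
  (forall x, ~~ in_chart I x -> f x = 0) /\
  exists (e : nat) (F : {mpoly k[n]}),
    F \is (e * #|I|).-homog /\
    forall x, in_chart I x -> f x = F.@[x 0] / (\prod_(i in I) x 0 i) ^+ e.

Definition regular_vec (W : vectType k) I (s : 'rV[k]_n -> W) : Prop :=
  forall l : 'Hom(W, k^o), regular I (fun x => l (s x)).

Variables (P : polyFunctor k) (r : nat) (g : 'I_n -> 'I_n -> 'rV[k]_n -> 'M[k]_r).

(* Transition matrices act on row vectors of coordinates. *)
Definition row_map (A : 'M[k]_r) : 'End('rV[k]_r) := linfun (mulmxr A).

(* The sections over U_I of P(E), for the bundle E with transition matrices g:
   s i is the coordinate vector of the section in the frame over U_i. *)
Definition is_section I (s : 'I_n -> 'rV[k]_n -> P 'rV[k]_r) : Prop :=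
  (forall i, regular_vec (i |: I) (s i)) /\
  (forall i j x, in_chart (i |: (j |: I)) x ->
    s j x = pf_map P (row_map (g i j x)) (s i x)).

Definition raw_cochain := {set 'I_n} -> 'I_n -> 'rV[k]_n -> P 'rV[k]_r.
HB.instance Definition _ := GRing.Lmodule.on raw_cochain.

(* Cochains are indexed by the number p of intersecting charts: Cech degree q
   is p = q + 1.  The empty set of charts is excluded, so that all cochains are
   zero for p = 0, and so are all coboundaries in Cech degree 0. *)
Definition cochain (p : nat) (c : raw_cochain) : Prop :=
  forall I, if (#|I| == p) && (I != set0) then is_section I (c I) else c I = 0.

(* The summand c (I :\ i) is restricted from U_(I :\ i) to U_I. *)
Definition cobound (c : raw_cochain) : raw_cochain := fun I j x =>
  if in_chart (j |: I) x then
    \sum_(i in I) (-1) ^+ #|[set l in I | (l < i)%N]| *: c (I :\ i) j x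
  else 0.

Definition cocycles (q : nat) : {pred raw_cochain} :=
  fun c => `[< cochain q.+1 c /\ cobound c = 0 >].

Definition coboundaries (q : nat) : {pred raw_cochain} :=
  fun c => `[< exists2 b, cochain q b & c = cobound b >].

Lemma regular0 I : regular I (fun=> 0).
Proof.
split=> //; exists 0%N, 0; split=> [|x _]; first exact: rpred0.
by rewrite meval0 mul0r.
Qed.

Lemma monomial_homog I :
  (\prod_(i in I) 'X_i : {mpoly k[n]}) \is #|I|.-homog.
Proof.
rewrite -sum1_card; apply: (big_ind2 (fun (F : {mpoly k[n]}) e => F \is e.-homog)).
- exact: dhomog1.
- by move=> F e G d; exact: dhomogM.
- by move=> i _; rewrite dhomogX /= mdeg1.
Qed.

Lemma regularD I a f h :
  regular I f -> regular I h -> regular I (fun x => a * f x + h x).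
Proof.
move=> [f0 [e [F [hF fE]]]] [h0 [d [G [hG hE]]]]; split=> [x xI|].
  by rewrite f0// h0// mulr0 addr0.
pose X : {mpoly k[n]} := \prod_(i in I) 'X_i.
have hX m : X ^+ m \is (m * #|I|).-homog.
  by rewrite mulnC; apply: dhomogMn; exact: monomial_homog.
exists (e + d)%N, (a *: (F * X ^+ d) + G * X ^+ e); split=> [|x xI].
  apply: rpredD; first apply: rpredZ.
    by rewrite mulnDl; exact: dhomogM.
  by rewrite addnC mulnDl; exact: dhomogM.
have XE : X.@[x 0] = \prod_(i in I) x 0 i.
  by rewrite rmorph_prod; apply: eq_bigr => i _; exact: mevalXU.
have X0 : \prod_(i in I) x 0 i != 0.
  by apply/prodf_neq0 => i iI; move/forall_inP: xI; exact.
rewrite fE// hE// mevalD mevalZ !mevalM !rmorphXn /= XE exprD.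
by field; rewrite !expf_neq0.
Qed.

Lemma is_section0 I : is_section I 0.
Proof.
split=> [i l|i j x _]; last by rewrite /= linear0.
by have -> : (fun x => l ((0 : 'rV[k]_n -> P 'rV[k]_r) x)) = fun=> 0;
  [apply/funext => x; rewrite linear0|exact: regular0].
Qed.

Lemma is_sectionD I a s t :
  is_section I s -> is_section I t -> is_section I (a *: s + t).
Proof.
move=> [regs gs] [regt gt]; split=> [i l|i j x xI].
  have -> : (fun x => l ((a *: s + t) i x)) = fun x => a * l (s i x) + l (t i x).
    by apply/funext => x; rewrite -[LHS]/(l (a *: s i x + t i x)) linearP.
  exact: regularD (regs i l) (regt i l).
rewrite -[LHS]/(a *: s j x + t j x) (gs i j x xI) (gt i j x xI).
by rewrite -[RHS]/(pf_map P (row_map (g i j x)) (a *: s i x + t i x)) linearP.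
Qed.

Lemma cochain0 p : cochain p 0.
Proof. by move=> I; case: ifP => // _; exact: is_section0. Qed.

Lemma cochainD p a b c : cochain p b -> cochain p c -> cochain p (a *: b + c).
Proof.
move=> hb hc I; have := hb I; have := hc I; case: ifP => _; last first.
  by move=> c0 b0; rewrite -[LHS]/(a *: b I + c I) b0 c0 scaler0 addr0.
by move=> sc sb; exact: is_sectionD.
Qed.

Lemma coboundD a b c : cobound (a *: b + c) = a *: cobound b + cobound c.
Proof.
apply/funext => I; apply/funext => j; apply/funext => x.
rewrite -[RHS]/(a *: cobound b I j x + cobound c I j x) /cobound.
case: ifP => _; last by rewrite scaler0 addr0.
rewrite scaler_sumr -big_split; apply: eq_bigr => i _ /=.
rewrite -[(_ + _) _ _ _]/(a *: b (I :\ i) j x + c (I :\ i) j x).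
by rewrite scalerDr !scalerA mulrC.
Qed.

Lemma cobound0 : cobound 0 = 0.
Proof. by have := coboundD (-1) 0 0; rewrite scaler0 addr0 scaleN1r addNr. Qed.

Lemma cocycles_closed q : GRing.subsemimod_closed (cocycles q).
Proof.
apply: asbool_submod_closed => [|a b c [hb db] [hc dc]].
  by split; [exact: cochain0|exact: cobound0].
by split; [exact: cochainD|rewrite coboundD db dc scaler0 addr0].
Qed.
HB.instance Definition _ q :=
  GRing.isSubmodClosed.Build k raw_cochain (cocycles q) (@cocycles_closed q).

Lemma coboundaries_closed q : GRing.subsemimod_closed (coboundaries q).
Proof.
apply: asbool_submod_closed => [|a _ _ [b hb ->] [c hc ->]].
  by exists 0; [exact: cochain0|rewrite cobound0].
by exists (a *: b + c); [exact: cochainD|rewrite coboundD].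
Qed.
HB.instance Definition _ q :=
  GRing.isSubmodClosed.Build k raw_cochain (coboundaries q) (@coboundaries_closed q).

(* H^q(P^(n-1), P(E)), for the bundle E with transition matrices g *)
Definition cohomology (q : nat) : lmodType k :=
  subquot (cocycles q) (coboundaries q).

End Projective.

(* Over U_i, Omega has the frame dz^i_a := d(x_(lift i a) / x_i), where
   lift i a runs over the indices other than i.  In terms of the coordinates
   y := x / x_j on U_j (with y_j = 1), dz^i_a is the sum over b of the
   d(y_(lift i a) / y_i) / d(y_(lift j b)) times dz^j_b; these partial
   derivatives, given by the quotient rule, form the transition matrix. *)
Definition cotangent (k : fieldType) (n : nat) (i j : 'I_n) (x : 'rV[k]_n) :
    'M[k]_n.-1 :=
  let y l := x 0 l / x 0 j in
  \matrix_(a, b) (((lift i a == lift j b)%:R * y i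
                    - y (lift i a) * (i == lift j b)%:R) / y i ^+ 2).

Definition HOmega (k : fieldType) (P : polyFunctor k) (n q : nat) : lmodType k :=
  cohomology P (@cotangent k n) q.

Definition lmod_iso (k : fieldType) (V W : lmodType k) : Prop :=
  exists f : {linear V -> W}, bijective f.

(* Main.v *)
(* Let Z be the space of vectors of k^n with coordinate sum 0.  On the torus
   {x_0 ... x_(n-1) != 0} of P^(n-1), the logarithmic forms dx_l/x_l - dx_j/x_j
   trivialize Omega with fibre Z, so that a section of P(Omega) over U_I is a
   finite sum of x^w p_w with p_w in P(Z) and w in Z^n of total degree 0.
   Regularity along x_l = 0, for l outside of I, bounds the l-weights of p_w by
   w_l.  Hence the Cech complex is the direct sum of subcomplexes C_w.

   Let i be an index.  On the cochains of C_w supported on the sets I that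
   contain i, the torus weights b of P(k^(n-1)) split off in the chart U_i; if
   b_l <= w_l for some l != i, then the part of weight b is contracted by adding
   l to I.  What remains lives in Cech degree n - 1 only, and is zero there if
   d < n - 1 - w_i, because b has total degree d.

   If w != 0, then w_i < 0 for some i and all of C_w is supported on the sets I
   containing i; so C_w is exact in degree q if q < n - 1 or d <= n - 1.  The
   complex C_0 consists of the P(Z_I), where Z_I is the space of the vectors of Z
   supported on I.  The kernel of the restriction from the C_0 of n + 1 to the
   one of n consists of the cochains supported on the sets containing a given
   index, so that the restriction is an isomorphism in cohomology in the degrees
   q with q < n - 1 or d <= n - 1.  This gives (1) and (2), and (3) follows by
   going down to n = d + 1, where there are no cochains of degree > d. *)
Require Import Defs.
From HB Require Import structures.
From mathcomp Require Import all_boot all_order all_algebra.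
From mathcomp Require Import boolp functions mpoly ring.

Set Implicit Arguments.
Unset Strict Implicit.
Unset Printing Implicit Defensive.

Import Order.TTheory GRing.Theory Num.Theory.
Local Open Scope ring_scope.

(** * Isomorphisms of subquotients *)

Lemma lmod_iso_bij (k : fieldType) (V W : lmodType k) (f : V -> W) :
  linear f -> injective f -> (forall y, exists x, f x = y) -> lmod_iso V W.
Proof.
move=> fL fI /choice[g gK].
pose F : {linear V -> W} := HB.pack f (GRing.isLinear.Build k V W _ f fL).
by exists F; exists g => // x; apply: fI; rewrite gK.
Qed.

Lemma lmod_iso_refl (k : fieldType) (V : lmodType k) : lmod_iso V V.
Proof. by exists idfun; exists idfun. Qed.

Lemma lmod_iso_sym (k : fieldType) (V W : lmodType k) : lmod_iso V W -> lmod_iso W V.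
Proof.
move=> [f [g fK gK]]; apply: (@lmod_iso_bij _ _ _ g).
- by move=> a u v; apply: (can_inj fK); rewrite linearP !gK.
- exact: can_inj gK.
- by move=> y; exists (f y).
Qed.

Lemma lmod_iso_trans (k : fieldType) (U V W : lmodType k) :
  lmod_iso U V -> lmod_iso V W -> lmod_iso U W.
Proof.
move=> [f fb] [g gb]; exists (g \o f); exact: bij_comp.
Qed.

Section SubquotIso.
Variables (k : fieldType) (V V' : lmodType k).
Variables (Z B : submodClosed V) (Z' B' : submodClosed V') (f : {linear V -> V'}).
Hypotheses (fZ : forall z, z \in Z -> f z \in Z')
  (fB : forall z, z \in Z -> z \in B -> f z \in B')
  (fI : forall z, z \in Z -> f z \in B' -> z \in B)
  (fS : forall z', z' \in Z' -> exists2 z, z \in Z & z' - f z \in B').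

Let lift_sub (u : submod Z) : submod Z' := Sub (f (val u)) (fZ (valP u)).

Let F (x : subquot Z B) : subquot Z' B' := lquot_pi _ (lift_sub (repr x)).

Let piP (u v : submod Z) :
  (lquot_pi (@submod_in k V Z B) u = lquot_pi _ v) <-> val u - val v \in B.
Proof.
have -> : val u - val v = val (u - v) by rewrite (raddfB (val : submod Z -> V)).
by split=> [/lquot_eqP|H]; [|apply/lquot_eqP].
Qed.

Let piP' (u v : submod Z') :
  (lquot_pi (@submod_in k V' Z' B') u = lquot_pi _ v) <-> val u - val v \in B'.
Proof.
have -> : val u - val v = val (u - v) by rewrite (raddfB (val : submod Z' -> V')).
by split=> [/lquot_eqP|H]; [|apply/lquot_eqP].
Qed.

Let lift_val u : val (lift_sub u) = f (val u). Proof. by []. Qed.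

Let F_pi u : F (lquot_pi _ u) = lquot_pi _ (lift_sub u).
Proof.
rewrite /F; apply: (piP' _ _).2; rewrite !lift_val -linearB.
have sE (x y : submod Z) : val x - val y = val (x - y).
  by rewrite (raddfB (val : submod Z -> V)).
apply: fB; first by rewrite sE; exact: valP.
by apply: (piP _ _).1; rewrite lquot_reprK.
Qed.

(** The map [F] on classes is computed on representatives: [fB] makes it independent of their
    choice, [fI] gives injectivity, and [fS] surjectivity. *)
Lemma subquot_iso : lmod_iso (subquot Z B) (subquot Z' B').
Proof.
apply: (@lmod_iso_bij _ _ _ F).
- move=> a x y; rewrite -(lquot_reprK x) -(lquot_reprK y).
  set u := repr x; set v := repr y.
  have -> : a *: (lquot_pi (@submod_in k V Z B) u : subquot Z B) + lquot_pi _ v =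
      lquot_pi _ (a *: u + v).
    by rewrite lquot_piD lquot_piZ.
  rewrite !F_pi.
  have -> : a *: (lquot_pi (@submod_in k V' Z' B') (lift_sub u) : subquot Z' B') +
      lquot_pi _ (lift_sub v) = lquot_pi _ (a *: lift_sub u + lift_sub v).
    by rewrite lquot_piD lquot_piZ.
  congr (lquot_pi _ _); apply: val_inj; rewrite lift_val.
  rewrite (_ : val (a *: u + v) = a *: val u + val v)//.
  by rewrite (_ : val (_ + _) = a *: f (val u) + f (val v))// linearP.
- move=> x y; rewrite -(lquot_reprK x) -(lquot_reprK y) !F_pi.
  move=> /(piP' _ _).1; rewrite !lift_val -linearB => H; apply: (piP _ _).2.
  apply: fI H; have -> : val (repr x) - val (repr y) = val (repr x - repr y :> submod Z).
    by rewrite (raddfB (val : submod Z -> V)).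
  exact: valP.
- move=> y; have [z zZ zB] := fS (valP (repr y)).
  exists (lquot_pi _ (Sub z zZ)); rewrite F_pi -[RHS]lquot_reprK.
  apply: (piP' _ _).2; rewrite lift_val.
  have -> : f z - val (repr y) = (-1) *: (val (repr y) - f z).
    by rewrite scaleN1r opprB.
  exact: rpredZ.
Qed.

End SubquotIso.

Lemma subquot_eq0 (k : fieldType) (V : lmodType k) (Z B : submodClosed V) :
  (forall z, z \in Z -> z \in B) -> forall h : subquot Z B, h = 0.
Proof.
move=> ZB h; rewrite -(lquot_reprK h) -[RHS]lquot_reprK; apply/lquot_eqP.
apply: ZB; exact: (valP (_ - _)).
Qed.

(** * Independence of characters *)

(** If q were nonzero, X q + 1 would be non-constant and have a root; but its value is 1 at 0 and at
    every zero of q. *)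
Lemma poly_vanish (k : closedFieldType) (q : {poly k}) :
  (forall t, t != 0 -> q.[t] = 0) -> q = 0.
Proof.
move=> q0; apply/eqP/negPn/negP => nz.
have /closed_rootP[x /eqP] : size ('X * q + 1) != 1%N.
  rewrite size_polyDl mulrC size_mulX// ?size_poly1 ?ltnS ?size_poly_gt0//.
  by rewrite eqSS size_poly_eq0.
rewrite !hornerE; have [->|/q0 ->] := eqVneq x 0.
  by rewrite mul0r add0r => /eqP; rewrite oner_eq0.
by rewrite mulr0 add0r => /eqP; rewrite oner_eq0.
Qed.

(** Otherwise X^|a - b| - 1, of positive degree, would vanish at every nonzero t. *)
Lemma exprz_sep (k : closedFieldType) (a b : int) :
  a != b -> exists2 t : k, t != 0 & t ^ a != t ^ b.
Proof.
move=> ab; apply: contrapT => H.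
have {}H (t : k) : t != 0 -> t ^ (a - b) = 1.
  move=> t0; have [e|e] := eqVneq (t ^ a) (t ^ b); last by case: H; exists t.
  by rewrite expfzDr// e -expfzDr// subrr.
have {}H (t : k) : t != 0 -> t ^+ `|a - b|%N = 1.
  move=> t0; have := H t t0; case: (a - b) => [l|l] //= /(congr1 GRing.inv).
  by rewrite invrK invr1.
have : 'X^(`|a - b|%N) - 1 = 0 :> {poly k}.
  by apply: poly_vanish => t t0; rewrite !hornerE H// subrr.
move/(congr1 (fun p : {poly k} => size p)); rewrite size_XnsubC ?size_poly0//.
by rewrite absz_gt0 subr_eq0.
Qed.

Lemma sum_fibers (V : nmodType) (I : Type) (E : eqType) (e : I -> E) (r : seq E)
    (s : seq I) (F : I -> V) : uniq r -> {subset map e s <= r} ->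
  \sum_(i <- s) F i = \sum_(b <- r) \sum_(i <- s | e i == b) F i.
Proof.
move=> ur; elim: s => [|i s IH] sr.
  by rewrite big_nil big1// => b _; rewrite big_nil.
rewrite big_cons IH; last by move=> b bs; rewrite sr//= inE bs orbT.
transitivity (\sum_(b <- r) ((if e i == b then F i else 0) +
    \sum_(j <- s | e j == b) F j)); last first.
  by apply: eq_bigr => b _; rewrite big_cons; case: ifP => // _; rewrite add0r.
rewrite big_split /=; congr (_ + _).
rewrite (bigD1_seq (e i)) ?sr ?mem_head//= eqxx big1 ?addr0// => b.
by rewrite eq_sym => /negPf ->.
Qed.

Section Characters.
Variables (k : fieldType) (W : lmodType k) (E : eqType) (G : Type).
Variables (D : G -> Prop) (op : G -> G -> G) (one : G) (chi : E -> G -> k).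
Hypotheses (D1 : D one) (DM : forall g h, D g -> D h -> D (op g h)).
Hypotheses (chi1 : forall e, chi e one = 1)
  (chiM : forall e g h, D g -> D h -> chi e (op g h) = chi e g * chi e h)
  (chi_sep : forall e e', e != e' -> exists2 g, D g & chi e g != chi e' g).

(* Artin's argument: subtracting chi e0 h times the relation at g from the
   relation at h g kills the term at e0. *)
Lemma characters_free (r : seq E) (v : E -> W) : uniq r ->
  (forall g, D g -> \sum_(e <- r) chi e g *: v e = 0) ->
  forall e, e \in r -> v e = 0.
Proof.
elim: r v => [|e0 r IH] v //= /andP[e0r ur] H.
have vr e : e \in r -> v e = 0.
  move=> er; have /chi_sep[h Dh] : e != e0 by apply: contraNneq e0r => <-.
  rewrite -subr_eq0 => c0; apply/eqP; have := scaler_eq0 (chi e h - chi e0 h) (v e).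
  rewrite (negPf c0) /= => <-; apply/eqP.
  apply: (IH (fun e => (chi e h - chi e0 h) *: v e)) => // g Dg.
  have Hhg := H _ (DM Dh Dg); have Hg := congr1 ( *:%R (chi e0 h)) (H g Dg).
  rewrite big_cons chiM// in Hhg; rewrite big_cons scaler0 scalerDr scalerA in Hg.
  have /addrI eqS := etrans Hg (esym Hhg).
  rewrite -[RHS](subrr (\sum_(e <- r) chi e (op h g) *: v e)) -[in X in _ - X]eqS.
  rewrite scaler_sumr -sumrB; apply: eq_bigr => f _.
  by rewrite chiM// !scalerA -scalerBl; congr (_ *: _); ring.
move=> e; rewrite inE => /predU1P[->|/vr//].
have := H one D1; rewrite big_cons big_seq big1 => [|f /vr ->]; last by rewrite scaler0.
by rewrite chi1 scale1r addr0.
Qed.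

(** Characters may be repeated along [s], so only the total coefficient of each of them has to
    vanish. *)
Lemma characters_free_seq (I : Type) (s : seq I) (e : I -> E) (v : I -> W) :
  (forall g, D g -> \sum_(i <- s) chi (e i) g *: v i = 0) ->
  forall a, \sum_(i <- s | e i == a) v i = 0.
Proof.
(* [a] is added to the list so that a character that does not occur in [s] is covered too. *)
move=> H a; pose r := undup (a :: map e s).
apply: (@characters_free r (fun b => \sum_(i <- s | e i == b) v i)).
- exact: undup_uniq.
- move=> g Dg; rewrite -[RHS](H g Dg) [RHS](@sum_fibers _ _ _ e r).
  + apply: eq_bigr => b _; rewrite scaler_sumr.
    by apply: eq_bigr => i /eqP ->.
  + exact: undup_uniq.
  + by move=> b; rewrite mem_undup inE orbC => ->.
- by rewrite mem_undup mem_head.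
Qed.
End Characters.

Lemma powers_free (k : closedFieldType) (W : lmodType k) (I : Type) (s : seq I)
    (e : I -> int) (v : I -> W) :
  (forall t, t != 0 -> \sum_(i <- s) t ^ e i *: v i = 0) ->
  forall a, \sum_(i <- s | e i == a) v i = 0.
Proof.
move=> H; apply: (@characters_free_seq k W int k (fun t => t != 0) *%R 1
  (fun a t => t ^ a)) => //.
- exact: oner_neq0.
- by move=> g h g0 h0; rewrite mulf_neq0.
- by move=> a; rewrite exp1rz.
- by move=> a g h g0 h0; rewrite exprzMl ?unitfE.
- exact: exprz_sep.
Qed.

Section Monomials.
Variables (k : closedFieldType) (n : nat).

Definition expo := {ffun 'I_n -> int}.
Definition torus (x : 'rV[k]_n) := forall l, x 0 l != 0.
Definition mono (x : 'rV[k]_n) (a : expo) : k := \prod_l x 0 l ^ a l.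

Lemma monomials_free (W : lmodType k) (I : Type) (s : seq I)
    (e : I -> expo) (v : I -> W) :
  (forall x, torus x -> \sum_(i <- s) mono x (e i) *: v i = 0) ->
  forall a, \sum_(i <- s | e i == a) v i = 0.
Proof.
move=> H; apply: (@characters_free_seq k W expo 'rV[k]_n torus
  (fun x y => \row_l (x 0 l * y 0 l)) (const_mx 1) (fun a x => mono x a)) => //.
- by move=> l; rewrite mxE oner_neq0.
- by move=> x y xT yT l; rewrite mxE mulf_neq0.
- by move=> a; rewrite /mono big1// => l _; rewrite mxE exp1rz.
- move=> a x y xT yT; rewrite /mono -big_split; apply: eq_bigr => l _ /=.
  by rewrite mxE exprzMl ?unitfE.
(* Distinct exponents differ at some l; a point with all coordinates 1 except the one at l separates
   them. *)
- move=> a b ab; have [l abl] : exists l, a l != b l.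
    apply/existsP; rewrite -negb_forall; apply: contra ab => /forallP ab.
    by apply/eqP/ffunP => l; apply/eqP.
  have [t t0 tab] := exprz_sep k abl.
  exists (\row_m (if m == l then t else 1)).
    by move=> m; rewrite mxE; case: ifP => // _; exact: oner_neq0.
  suff E c : mono (\row_m (if m == l then t else 1)) c = t ^ c l by rewrite !E.
  rewrite /mono (bigD1 l)//= big1 ?mulr1 ?mxE ?eqxx// => m /negPf ml.
  by rewrite mxE ml exp1rz.
Qed.
End Monomials.

(** * The weights of a polynomial functor *)

Section MatrixAction.
Variables (k : closedFieldType) (P : polyFunctor k).

Definition mxmap m n (A : 'M[k]_(m, n)) : 'Hom(P 'rV[k]_m, P 'rV[k]_n) :=
  pf_map P (linfun (mulmxr A)).

Lemma mxmap_mul m n p (A : 'M[k]_(m, n)) (B : 'M[k]_(n, p)) v :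
  mxmap (A *m B) v = mxmap B (mxmap A v).
Proof.
rewrite /mxmap -comp_lfunE -pf_map_comp; congr (pf_map P _ v).
by apply/lfunP => u; rewrite comp_lfunE !lfunE /= mulmxA.
Qed.

Lemma mxmap1 m v : mxmap (1%:M : 'M[k]_m) v = v.
Proof.
rewrite /mxmap (_ : linfun _ = \1%VF) ?pf_map_id ?lfunE//.
by apply/lfunP => u; rewrite !lfunE /= mulmx1.
Qed.

(** The arguments of [Q l] are the coordinates of the linear map of A in a basis of the Hom space.
    They are linear in the entries of A, and C holds the coordinates of the elementary matrices. *)
Lemma mxmap_poly m n : exists (r s : nat) (Q : 'I_s -> {mpoly k[r]})
    (C : 'I_r -> 'I_m -> 'I_n -> k) (B : 'I_s -> 'Hom(P 'rV[k]_m, P 'rV[k]_n)),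
  forall A, mxmap A =
    \sum_l (Q l).@[fun i => \sum_a \sum_b A a b * C i a b] *: B l.
Proof.
have [Q QE] := choice (@pf_map_poly _ P 'rV[k]_m 'rV[k]_n).
pose bs := vbasis {: 'Hom('rV[k]_m, 'rV[k]_n)}.
exists _, _, Q, (fun i a b => coord bs i (linfun (mulmxr (delta_mx a b)))).
exists (fun l => (vbasis fullv)`_l) => A.
rewrite [LHS](coord_vbasis (memvf _)); apply: eq_bigr => l _; congr (_ *: _).
rewrite QE; apply: meval_eq => i; rewrite -/bs.
have -> : linfun (mulmxr A) =
    \sum_a \sum_b A a b *: linfun (mulmxr (delta_mx a b)) :> 'Hom('rV[k]_m, 'rV[k]_n).
  apply/lfunP => u; rewrite !lfunE /= {1}[A]matrix_sum_delta mulmx_sumr sum_lfunE.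
  apply: eq_bigr => a _; rewrite mulmx_sumr sum_lfunE; apply: eq_bigr => b _.
  by rewrite !lfunE /= lfunE /= scalemxAr.
rewrite linear_sum; apply: eq_bigr => a _; rewrite linear_sum.
by apply: eq_bigr => b _; rewrite linearZ.
Qed.

Variables (d : nat) (hP : of_degree d P).

Lemma mxmap_scalar m c v : mxmap (c%:M : 'M[k]_m) v = c ^+ d *: v.
Proof.
have := hP 'rV[k]_m c => /lfunP/(_ v); rewrite !lfunE /= lfunE /= => <-.
rewrite /mxmap (_ : linfun _ = c *: \1%VF)//.
by apply/lfunP => u; rewrite !lfunE /= lfunE /= mul_mx_scalar.
Qed.

Definition nmono m (t : 'rV[k]_m) (b : 'X_{1..m}) : k := \prod_a t 0 a ^+ b a.

(** On diagonal matrices [mxmap] is polynomial in the diagonal t, and [E b] is the coefficient of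
    the monomial t^b. Scaling t by c multiplies everything by c^d, so the monomials of degree d
    suffice. *)
Lemma weights_exist m : exists (N : nat) (E : 'X_{1..m < N} -> 'End(P 'rV[k]_m)),
  (forall b : 'X_{1..m < N}, mdeg b != d -> E b = 0) /\
  forall t v, mxmap (diag_mx t) v = \sum_(b : 'X_{1..m < N}) nmono t b *: E b v.
Proof.
have [r [s [Q [C [B PE]]]]] := mxmap_poly m m.
pose R l : {mpoly k[m]} := Q l \mPo [tuple \sum_a C i a a *: 'X_a | i < r].
pose N := \max_l (msize (R l)).
have RN l : (msize (R l) <= N)%N by exact: leq_bigmax.
pose F (b : 'X_{1..m < N}) := \sum_l (R l)@_b *: B l.
have FE t v : mxmap (diag_mx t) v = \sum_(b : 'X_{1..m < N}) nmono t b *: F b v.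
  rewrite PE sum_lfunE; under [RHS]eq_bigr do rewrite sum_lfunE scaler_sumr.
  rewrite exchange_big; apply: eq_bigr => l _ /=.
  under [RHS]eq_bigr do rewrite lfunE /= scalerA.
  rewrite lfunE /= -scaler_suml; congr (_ *: _).
  transitivity (R l).@[t 0].
    rewrite comp_mpoly_meval; apply: meval_eq => i; rewrite tnth_mktuple raddf_sum.
    apply: eq_bigr => a _; rewrite /= mevalZ mevalXU (bigD1 a)//= big1 ?addr0.
      by rewrite mxE eqxx mulr1n mulrC.
    by move=> b ba; rewrite mxE eq_sym (negPf ba) mulr0n mul0r.
  rewrite {1}(mpolywE (RN l)) raddf_sum; apply: eq_bigr => b _ /=.
  by rewrite mevalZ mevalX mulrC.
(* The coefficients in the other degrees are replaced by zero; it remains to see that the sum does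
   not change. *)
exists N, (fun b : 'X_{1..m < N} => if mdeg b == d then F b else 0); split=> [b /negPf ->//|t v].
pose L := index_enum 'X_{1..m < N}.
(* [None] stands for the left-hand side, moved across with exponent d. Homogeneity becomes a
   vanishing sum of powers of c, of which the coefficient of c^d is extracted. *)
pose deg o : int := if o is Some b then (mdeg (b : 'X_{1..m < N})) else d.
pose val o := if o is Some b then nmono t (b : 'X_{1..m < N}) *: F b v
  else - mxmap (diag_mx t) v.
have : forall c, c != 0 -> \sum_(o <- None :: map Some L) c ^ deg o *: val o = 0.
  move=> c c0; rewrite big_cons big_map scalerN -exprnP -mxmap_scalar -mxmap_mul.
  rewrite mul_mx_scalar -linearZ /= FE addrC -sumrB big1// => b _.
  rewrite -exprnP scalerA -scalerBl -[RHS](scale0r (F b v)); congr (_ *: _).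
  apply/eqP; rewrite subr_eq0 /nmono mdegE -prodrXr -big_split /=.
  by apply/eqP/eq_bigr => a _; rewrite mxE exprMn.
move=> /powers_free/(_ (Posz d)); rewrite big_cons eqxx big_map.
rewrite addrC => /subr0_eq <-; rewrite big_mkcond; apply: eq_bigr => b _.
by rewrite eqz_nat; case: eqP => //; rewrite zero_lfunE scaler0.
Qed.

(** The bound on the degree makes the weights a finite type, over which sums can be taken. *)
Definition wbound m : nat := sval (cid (weights_exist m)).
Definition weight m := 'X_{1..m < wbound m}.
Definition wproj m : weight m -> 'End(P 'rV[k]_m) :=
  sval (cid (svalP (cid (weights_exist m)))).

Let wprojP m := svalP (cid (svalP (cid (weights_exist m)))).

Lemma wproj_deg m (b : weight m) : mdeg b != d -> wproj b = 0.
Proof. exact: (wprojP m).1. Qed.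

Lemma mxmap_diag m t v : mxmap (diag_mx t) v = \sum_(b : weight m) nmono t b *: wproj b v.
Proof. exact: (wprojP m).2. Qed.

Lemma wproj_sum m v : \sum_(b : weight m) wproj b v = v.
Proof.
rewrite -[RHS](mxmap1 v) -diag_const_mx mxmap_diag; apply: eq_bigr => b _.
by rewrite /nmono big1 ?scale1r// => a _; rewrite mxE expr1n.
Qed.

Lemma nmono_free m (W : lmodType k) (v : weight m -> W) :
  (forall t, torus t -> \sum_b nmono t (b : weight m) *: v b = 0) -> forall b, v b = 0.
Proof.
pose e (b : weight m) : expo m := [ffun a => Posz ((b : 'X_{1..m}) a)].
have ei : injective e.
  move=> b c /ffunP bc; apply/val_inj/mnmP => a; have := bc a.
  by rewrite !ffunE => -[].
move=> H b; have := @monomials_free _ _ _ _ (index_enum (weight m)) e v _ (e b).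
under eq_bigl do rewrite (inj_eq ei); rewrite big_pred1_eq; apply=> t tT.
by rewrite -[RHS](H t tT); apply: eq_bigr => c _; congr (_ *: _); apply: eq_bigr => a _; rewrite ffunE.
Qed.

(** Let [diag_mx u] act first and [diag_mx t] second, and compare the coefficients of the monomials
    in u with those of the action of the product. *)
Lemma mxmap_diag_wproj m t (b : weight m) v :
  mxmap (diag_mx t) (wproj b v) = nmono t b *: wproj b v.
Proof.
apply/subr0_eq; move: b; apply: nmono_free => u _.
under eq_bigr do rewrite scalerBr -linearZ; rewrite sumrB -linear_sum /=.
rewrite -mxmap_diag -mxmap_mul; apply/eqP; rewrite subr_eq0; apply/eqP.
rewrite mulmx_diag mxmap_diag; apply: eq_bigr => b _; rewrite scalerA; congr (_ *: _).
by rewrite /nmono -big_split; apply: eq_bigr => a _ /=; rewrite mxE exprMn.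
Qed.

(** A vector of weight c is scaled by the monomial of c, so independence of monomials leaves only
    this term in its weight expansion. *)
Lemma wprojK m (b c : weight m) v :
  wproj b (wproj c v) = if b == c then wproj c v else 0.
Proof.
apply/subr0_eq; move: b; apply: nmono_free => t tT.
under eq_bigr do rewrite scalerBr; rewrite sumrB -mxmap_diag mxmap_diag_wproj.
apply/eqP; rewrite subr_eq0 (bigD1 c)//= eqxx big1 ?addr0// => b /negPf ->.
by rewrite scaler0.
Qed.

End MatrixAction.

(** * Polynomial curves *)

Section PolynomialCurves.
Variables (k : closedFieldType).

Definition polyfun (f : k -> k) := exists q : {poly k}, forall t, f t = q.[t].

Definition vpolyfun (W : lmodType k) (f : k -> W) :=
  exists L : seq (nat * W), forall t, f t = \sum_(y <- L) t ^+ y.1 *: y.2.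

(** Laurent polynomials with a pole of order at most w at infinity; the value at 0 is
    unconstrained. *)
Definition laurent_le (W : lmodType k) (w : int) (f : k -> W) :=
  exists2 L : seq (int * W), all (fun y => y.1 <= w) L &
    forall t, t != 0 -> f t = \sum_(y <- L) t ^ y.1 *: y.2.

Lemma polyfunC c : polyfun (fun=> c).
Proof. by exists c%:P => t; rewrite hornerC. Qed.

Lemma polyfunD f g : polyfun f -> polyfun g -> polyfun (fun t => f t + g t).
Proof. by move=> [p pE] [q qE]; exists (p + q) => t; rewrite pE qE hornerD. Qed.

Lemma polyfunM f g : polyfun f -> polyfun g -> polyfun (fun t => f t * g t).
Proof. by move=> [p pE] [q qE]; exists (p * q) => t; rewrite pE qE hornerM. Qed.

Lemma polyfun_exp n : polyfun (fun t => t ^+ n).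
Proof. by exists 'X^n => t; rewrite hornerXn. Qed.

Lemma polyfunX f n : polyfun f -> polyfun (fun t => f t ^+ n).
Proof. by move=> [p pE]; exists (p ^+ n) => t; rewrite pE horner_exp. Qed.

Lemma polyfun_sum (I : Type) (s : seq I) (f : I -> k -> k) :
  (forall i, polyfun (f i)) -> polyfun (fun t => \sum_(i <- s) f i t).
Proof.
move=> /choice[p pE]; exists (\sum_(i <- s) p i) => t.
by rewrite horner_sum; apply: eq_bigr => i _.
Qed.

Lemma polyfun_prod (I : Type) (s : seq I) (f : I -> k -> k) :
  (forall i, polyfun (f i)) -> polyfun (fun t => \prod_(i <- s) f i t).
Proof.
move=> /choice[p pE]; exists (\prod_(i <- s) p i) => t.
by rewrite horner_prod; apply: eq_bigr => i _.
Qed.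

Lemma polyfun_meval n (q : {mpoly k[n]}) (f : 'I_n -> k -> k) :
  (forall i, polyfun (f i)) -> polyfun (fun t => q.@[fun i => f i t]).
Proof.
move=> fP; have [p pE] := @polyfun_sum _ (msupp q)
  (fun m t => q@_m * \prod_i f i t ^+ m i)
  (fun m => polyfunM (polyfunC _) (polyfun_prod _ (fun i => polyfunX (m i) (fP i)))).
by exists p => t; rewrite mevalE -pE.
Qed.

Section Vectors.
Variable W : lmodType k.
Implicit Types f : k -> W.

Lemma vpolyfun_sum (I : Type) (s : seq I) (f : I -> k -> W) :
  (forall i, vpolyfun (f i)) -> vpolyfun (fun t => \sum_(i <- s) f i t).
Proof.
move=> /choice[L LE]; exists (flatten (map L s)) => t.
by rewrite big_flatten /= big_map; apply: eq_bigr => i _.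
Qed.

Lemma vpolyfunZ (g : k -> k) (v : W) : polyfun g -> vpolyfun (fun t => g t *: v).
Proof.
move=> [q qE]; exists [seq (i, q`_i *: v) | i <- iota 0 (size q)] => t.
rewrite qE horner_coef scaler_suml big_map -[iota _ _]val_enum_ord big_map.
by rewrite -big_enum /=; apply: eq_bigr => i _; rewrite scalerA mulrC.
Qed.

Lemma vpolyfunZf (g : k -> k) f :
  polyfun g -> vpolyfun f -> vpolyfun (fun t => g t *: f t).
Proof.
move=> gP [L LE]; have [L' L'E] := @vpolyfun_sum _ L
  (fun y t => (g t * t ^+ y.1) *: y.2)
  (fun y => vpolyfunZ y.2 (polyfunM gP (polyfun_exp y.1))).
exists L' => t; rewrite -L'E LE scaler_sumr.
by apply: eq_bigr => y _; rewrite scalerA.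
Qed.

Lemma vpolyfun_sub f g : vpolyfun f -> vpolyfun g -> vpolyfun (fun t => f t - g t).
Proof.
move=> [L LE] [M ME]; exists (L ++ [seq (y.1, - y.2) | y <- M]) => t.
rewrite big_cat big_map /= LE ME -sumrN; congr (_ + _).
by apply: eq_bigr => y _; rewrite scalerN.
Qed.

(** The value at 0 is the constant coefficient, which vanishes by independence of powers. This
    replaces density arguments: identities extend from t != 0 to t = 0. *)
Lemma vpolyfun_vanish f : vpolyfun f -> (forall t, t != 0 -> f t = 0) -> f 0 = 0.
Proof.
move=> [L LE] f0; rewrite LE (bigID (fun y => Posz y.1 == 0)) /=.
rewrite [X in _ + X]big1 ?addr0 => [|y]; last first.
  by rewrite eqz_nat expr0n => /negPf ->; rewrite scale0r.
transitivity (\sum_(y <- L | Posz y.1 == 0) y.2).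
  by apply: eq_bigr => y /eqP[->]; rewrite expr0 scale1r.
apply: powers_free => t t0; rewrite -[RHS](f0 t t0) LE.
by apply: eq_bigr => y _.
Qed.

Lemma laurent_le_sum (I : Type) (s : seq I) (w : int) (f : I -> k -> W) :
  (forall i, laurent_le w (f i)) -> laurent_le w (fun t => \sum_(i <- s) f i t).
Proof.
move=> fL; have /choice[L LE] i : exists L : seq (int * W), all (fun y => y.1 <= w) L /\
    forall t, t != 0 -> f i t = \sum_(y <- L) t ^ y.1 *: y.2.
  by have [L] := fL i; exists L.
exists (flatten (map L s)).
  by elim: s => //= i s IH; rewrite all_cat IH (LE i).1.
move=> t t0; rewrite big_flatten /= big_map; apply: eq_bigr => i _.
by case: (LE i) => _; exact.
Qed.

Lemma laurent_le_coef (I : Type) (s : seq I) (w : int) (e : I -> int) (v : I -> W) :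
  laurent_le w (fun t => \sum_(i <- s) t ^ e i *: v i) ->
  forall c, w < c -> \sum_(i <- s | e i == c) v i = 0.
Proof.
move=> [L Lw LE] c wc.
(* [M] is the difference of the two expansions; an exponent c > w occurs in the first one only. *)
pose M := [seq (e i, v i) | i <- s] ++ [seq (y.1, - y.2) | y <- L].
have /(_ c) : forall a, \sum_(y <- M | y.1 == a) y.2 = 0.
  apply: powers_free => t t0; rewrite big_cat !big_map LE//= -big_split big1// => y _.
  by rewrite /= scalerN subrr.
rewrite big_cat !big_map /= [X in _ + X](_ : _ = 0) ?addr0// big_seq_cond big1//.
by move=> y /andP[/(allP Lw) yw /eqP yc]; rewrite yc leNgt wc in yw.
Qed.

End Vectors.

Lemma vpolyfun_mxmap (P : polyFunctor k) m n (A : k -> 'M[k]_(m, n)) v :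
  (forall a b, polyfun (fun t => A t a b)) -> vpolyfun (fun t => mxmap P (A t) v).
Proof.
move=> AP; have [r [s [Q [C [B PE]]]]] := mxmap_poly P m n.
have [L LE] := @vpolyfun_sum _ _ (index_enum 'I_s) (fun l t =>
    (Q l).@[fun i => \sum_a \sum_b A t a b * C i a b] *: B l v)
  (fun l => vpolyfunZ (B l v) (polyfun_meval (Q l) (fun i => polyfun_sum _ (fun a =>
    polyfun_sum _ (fun b => polyfunM (AP a b) (polyfunC (C i a b))))))).
exists L => t; rewrite -LE PE sum_lfunE; apply: eq_bigr => l _; exact: lfunE.
Qed.

End PolynomialCurves.

(** * Frames of the cotangent bundle *)

Section Frames.
Variables (k : fieldType) (m : nat).
Implicit Types i j : 'I_m.+1.

(* Z is the row space of frame_mx j, for every j; its row a is the logarithmic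
   form dz/z of the coordinate z = x_(lift j a) / x_j, and drop_mx j computes the
   coordinates of a vector of Z in this frame. *)
Definition drop_mx j : 'M[k]_(m.+1, m) := \matrix_(l, b) (l == lift j b)%:R.
Definition frame_mx j : 'M[k]_(m, m.+1) :=
  \matrix_(a, l) ((l == lift j a)%:R - (l == j)%:R).
Definition frame_change i j : 'M[k]_m :=
  \matrix_(a, b) ((lift i a == lift j b)%:R - (i == lift j b)%:R).

Lemma frame_drop i j : frame_mx i *m drop_mx j = frame_change i j.
Proof.
apply/matrixP => a b; rewrite !mxE (bigD1 (lift j b))//= big1.
  by rewrite !mxE eqxx mulr1 addr0 -!(eq_sym (lift j b)).
by move=> l lb; rewrite !mxE (negPf lb) mulr0.
Qed.

Lemma frame_dropK j : frame_mx j *m drop_mx j = 1%:M.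
Proof.
rewrite frame_drop; apply/matrixP => a b.
by rewrite !mxE (inj_eq lift_inj) (negPf (neq_lift _ _)) subr0.
Qed.

(** The product [drop_mx j *m frame_mx j] subtracts the coordinate sum from the coordinate j, so it
    fixes the rows of [frame_mx i], whose coordinate sums are zero. *)
Lemma frame_drop_frame i j : frame_mx i *m (drop_mx j *m frame_mx j) = frame_mx i.
Proof.
have -> : drop_mx j *m frame_mx j = 1%:M - \matrix_(l', l) (l == j)%:R.
  apply/matrixP => l' l; rewrite !mxE; have [a ->|->] := unliftP j l'.
    rewrite (bigD1 a)//= big1 => [|b ba].
      by rewrite !mxE eqxx mul1r addr0 eq_sym.
    by rewrite !mxE (inj_eq lift_inj) eq_sym (negPf ba) mul0r.
  rewrite big1 => [|a _]; first by rewrite eq_sym subrr.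
  by rewrite !mxE (negPf (neq_lift _ _)) mul0r.
rewrite mulmxBr mulmx1 [X in _ - X](_ : _ = 0) ?subr0//.
apply/matrixP => a l; rewrite !mxE.
transitivity ((\sum_l' frame_mx i a l') * (l == j)%:R).
  by rewrite mulr_suml; apply: eq_bigr => l' _; rewrite ?mxE.
rewrite (bigD1 (lift i a))//= (bigD1 i)/= ?neq_lift//.
rewrite big1 => [|l' /andP[l1 l2]]; last by rewrite mxE (negPf l1) (negPf l2) subrr.
rewrite !mxE !eqxx eq_sym (negPf (neq_lift i a)) sub0r subr0 addr0 subrr.
by rewrite mul0r.
Qed.

Definition scale_at (a : 'I_m) (t : k) : 'rV[k]_m := \row_c (if c == a then t else 1).

(* The conjugate of frame_change by the scaling of the coordinate lift j a =
   lift i a' is polynomial in the inverse s of the scaling factor. *)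
Definition frame_change_at i j (a a' : 'I_m) (s : k) : 'M[k]_m :=
  \matrix_(c, e) (frame_change i j c e * (if (c == a') && (e != a) then s else 1)).

Lemma frame_change_scale i j a a' t : t != 0 -> lift j a = lift i a' ->
  frame_change i j *m diag_mx (scale_at a t) =
    diag_mx (scale_at a' t) *m frame_change_at i j a a' t^-1.
Proof.
move=> t0 aa'; apply/matrixP => c e; rewrite mul_mx_diag mul_diag_mx !mxE.
have [->|ca] := eqVneq c a'; have [->|ea] := eqVneq e a => //=; try ring.
  by rewrite mulrCA divff// mulr1.
(* In the column a, the entries outside of the row a' are zero. *)
rewrite aa' (inj_eq lift_inj) (negPf ca) (negPf (neq_lift _ _)); ring.
Qed.

End Frames.

(** * Regularity of a weight component, and its independence of the chart *)

Section Admissible.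
Variables (k : closedFieldType) (P : polyFunctor k) (d : nat) (hP : of_degree d P).
Variable m : nat.
Implicit Types (w : expo m.+1) (I : {set 'I_m.+1}) (i j : 'I_m.+1) (p : P 'rV[k]_m.+1).

Lemma nmono_scale_at (a : 'I_m) (t : k) (b : weight hP m) : nmono (scale_at a t) b = t ^+ (b : 'X_{1..m}) a.
Proof.
rewrite /nmono (bigD1 a)//= big1 ?mulr1 ?mxE ?eqxx// => c /negPf ca.
by rewrite mxE ca expr1n.
Qed.

Definition balanced p j := mxmap P (drop_mx k j *m frame_mx k j) p = p.

Lemma balanced_any p i j : balanced p i -> balanced p j.
Proof.
rewrite /balanced => <-.
by rewrite -!mxmap_mul -!mulmxA frame_drop_frame.
Qed.

(* The condition, in the chart U_j, for x^w p to be regular on U_I; balanced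
   means that p lies in P(Z). *)
Definition holds_at w I p j := balanced p j /\
  forall (b : weight hP m) a, lift j a \notin I -> w (lift j a) < (b : 'X_{1..m}) a ->
    wproj b (mxmap P (drop_mx k j) p) = 0.

Definition admissible w I p := forall j, j \in I -> holds_at w I p j.

(* Over the scaling of one coordinate, the change of frames has only
   nonpositive powers, so that it preserves bounds on the weights. *)
Lemma holds_at_change w I p i j : i \in I -> holds_at w I p i -> holds_at w I p j.
Proof.
move=> iI [pi Hi]; split=> [|b a aI wb]; first exact: balanced_any pi.
have [a' aE|aE] := unliftP i (lift j a); last by rewrite aE iI in aI.
set v := mxmap P (drop_mx k i) p in Hi; set u := mxmap P (drop_mx k j) p.
have uE : u = mxmap P (frame_change k i j) v by rewrite -frame_drop -!mxmap_mul mulmxA mxmap_mul pi.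
(* Scaling the coordinate [lift j a] by t acts on the weight b part of u by t^(b a). Through the
   frame i, the same action is a scaling of v, with exponents at most w, followed by a polynomial in
   t^-1. *)
have : laurent_le (w (lift j a))
    (fun t => \sum_(b : weight hP m) t ^ Posz ((b : 'X_{1..m}) a) *: wproj b u).
  have [L LE Lt] : laurent_le (w (lift j a)) (fun t => \sum_(b : weight hP m)
      t ^+ (b : 'X_{1..m}) a' *: mxmap P (frame_change_at i j a a' t^-1) (wproj b v)).
    apply: laurent_le_sum => c.
    have [wc|cw] := ltP (w (lift j a)) (Posz ((c : 'X_{1..m}) a')).
      exists [::] => // t _; by rewrite (Hi c a') -?aE// linear0 scaler0 ?big_nil.
    have [|L LE] := @vpolyfun_mxmap _ P _ _ (frame_change_at i j a a') (wproj c v).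
      move=> e f; have [h|h] := boolP ((e == a') && (f != a)).
        by exists ((frame_change k i j e f)%:P * 'X) => t; rewrite !mxE h !hornerE.
      by exists ((frame_change k i j e f)%:P) => t; rewrite !mxE (negPf h) !hornerE.
    exists [seq (Posz ((c : 'X_{1..m}) a') - Posz y.1, y.2) | y <- L].
      rewrite all_map; apply/allP => y _ /=; apply: le_trans cw.
      by rewrite lerBlDr lerDl.
    move=> t t0; rewrite LE big_map scaler_sumr; apply: eq_bigr => y _ /=.
    by rewrite scalerA expfzDr// exprVn -exprnN.
  exists L => // t t0; rewrite -Lt//.
  transitivity (mxmap P (diag_mx (scale_at a t)) u).
    by rewrite (mxmap_diag hP); apply: eq_bigr => c _; rewrite nmono_scale_at.
  rewrite uE -mxmap_mul (frame_change_scale t0 aE) mxmap_mul (mxmap_diag hP) linear_sum.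
  by apply: eq_bigr => c _; rewrite linearZ nmono_scale_at.
(* A power of t collects all the weights with the same entry at a; [wproj b] isolates b among
   them. *)
move=> /laurent_le_coef/(_ _ wb)/(congr1 (wproj b)).
rewrite linear_sum linear0 (bigD1 b)//= wprojK eqxx big1 ?addr0// => c /andP[_ cb].
by rewrite wprojK eq_sym (negPf cb).
Qed.

Lemma admissible_at w I p i : i \in I -> holds_at w I p i -> admissible w I p.
Proof. by move=> iI H j _; exact: holds_at_change H. Qed.

Lemma holds_at_lin w I j a p q :
  holds_at w I p j -> holds_at w I q j -> holds_at w I (a *: p + q) j.
Proof.
move=> [p1 p2] [q1 q2]; split=> [|b c cI wb].
  by rewrite /balanced in p1 q1 *; rewrite linearP /= p1 q1.
by rewrite !linearP /= (p2 b c)// (q2 b c)// scaler0 addr0.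
Qed.

Lemma holds_at0 w I j : holds_at w I 0 j.
Proof. by split=> [|b c _ _]; rewrite /balanced !linear0. Qed.

End Admissible.

(** * Cochains supported on a star *)

Section Simplex.
Variables (k : fieldType) (n : nat).
Implicit Types (I : {set 'I_n}) (i l m : 'I_n).

Definition nbelow I i := #|[set l in I | (l < i)%N]|.

Lemma nbelowU I i m : m \notin I -> nbelow (m |: I) i = ((m < i) + nbelow I i)%N.
Proof.
move=> mI; rewrite /nbelow; have [mi|mi] := boolP (m < i)%N; last first.
  congr #|pred_of_set _|; apply/setP => l; rewrite !inE.
  by case: eqP => //= ->; rewrite (negPf mi) andbF.
have -> : [set l in m |: I | (l < i)%N] = m |: [set l in I | (l < i)%N].
  by apply/setP => l; rewrite !inE; case: eqP => //= ->.
by rewrite cardsU1 inE (negPf mI).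
Qed.

Lemma nbelowD I i m : m \in I -> nbelow I i = ((m < i) + nbelow (I :\ m) i)%N.
Proof. by move=> mI; rewrite -nbelowU ?setD1K// !inE eqxx. Qed.

Variable V : lmodType k.
Implicit Types c : {set 'I_n} -> V.

Definition delta c I : V := \sum_(i in I) (-1) ^+ nbelow I i *: c (I :\ i).

Definition contract m c I : V :=
  if m \in I then 0 else (-1) ^+ nbelow I m *: c (m |: I).

(** Adding the vertex m is a contracting homotopy of the augmented cochain complex of the full
    simplex. *)
Lemma contractK m c I : delta (contract m c) I + contract m (delta c) I = c I.
Proof.
rewrite {2}/contract; have [mI|mI] := boolP (m \in I).
  rewrite addr0 /delta (bigD1 m)//= big1 ?addr0 => [|l /andP[lI lm]].
    rewrite /contract !inE eqxx /= (nbelowD _ mI) ltnn setD1K//.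
    by rewrite scalerA -expr2 sqrr_sign scale1r.
  by rewrite /contract !inE eq_sym lm mI scaler0.
rewrite {2}/delta big_setU1//= setU1K// scalerDr scalerA (nbelowU _ mI) ltnn.
rewrite -expr2 sqrr_sign scale1r addrCA scaler_sumr -big_split big1 ?addr0//.
move=> l lI /=; have lm : l != m by apply: contraNneq mI => <-.
rewrite /contract !inE eq_sym (negPf lm) (negPf mI) /=.
have -> : (m |: I) :\ l = m |: (I :\ l).
  by apply/setP => x; rewrite !inE; have [->|] := eqVneq x l; rewrite ?(negPf lm).
rewrite !scalerA -scalerDl (nbelowU _ mI) (nbelowD m lI) !exprD.
rewrite [X in X *: _](_ : _ = 0) ?scale0r//.
(* Exactly one of the two inequalities holds, so the two signs are opposite. *)
have : ((m < l) (+) (l < m))%N.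
  by have := lm; rewrite -val_eqE /=; case: ltngtP.
by case: (m < l)%N; case: (l < m)%N => //= _; ring.
Qed.

Lemma delta_linear (V' : lmodType k) (f : {linear V -> V'}) c I :
  f (delta c I) = \sum_(i in I) (-1) ^+ nbelow I i *: f (c (I :\ i)).
Proof. by rewrite linear_sum; apply: eq_bigr => i _; rewrite linearZ. Qed.

(** Removing i and then l, or l and then i, gives opposite signs. [F] collects the pairs with i < l
    and [G] those with l < i. *)
Lemma deltaK c I : delta (delta c) I = 0.
Proof.
pose T i l := ((-1) ^+ nbelow I i * (-1) ^+ nbelow (I :\ i) l) *: c (I :\ i :\ l) : V.
pose F (i l : 'I_n) := if [&& i \in I, l \in I & (i < l)%N] then T i l else 0.
pose G (i l : 'I_n) := if [&& i \in I, l \in I & (l < i)%N] then T i l else 0.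
transitivity (\sum_i \sum_l (F i l + G i l)).
  rewrite /delta big_mkcond; apply: eq_bigr => i _.
  rewrite /F /G; case: (i \in I); last by rewrite big1// => l _; rewrite addr0.
  rewrite scaler_sumr big_mkcond; apply: eq_bigr => l _; rewrite !inE -val_eqE /=.
  by case: (l \in I) => /=; case: ltngtP => // _; rewrite ?addr0 ?add0r ?scalerA.
under eq_bigr do rewrite big_split; rewrite big_split /= [X in _ + X]exchange_big.
rewrite -big_split big1// => i _; rewrite -big_split big1// => l _ /=.
rewrite /F /G andbCA; case: ifP => [/and3P[lI iI il]|_]; last by rewrite addr0.
rewrite /T setDDl setUC -setDDl -scalerDl (nbelowD l iI) (nbelowD i lI) il ltnNge ltnW//=.
by rewrite !exprD [X in X *: _](_ : _ = 0) ?scale0r//; ring.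
Qed.
End Simplex.

Section Exactness.
Variables (k : closedFieldType) (P : polyFunctor k) (d : nat) (hP : of_degree d P).
Variable m : nat.
Implicit Types (w : expo m.+1) (I : {set 'I_m.+1}) (i j : 'I_m.+1).
Implicit Types (c : {set 'I_m.+1} -> P 'rV[k]_m.+1).

(** The subcomplex C_w, indexed by the number of charts as in [cochain]. *)
Definition wcochain w q c := forall I,
  if (#|I| == q) && (I != set0) then admissible hP w I (c I) else c I = 0.

Lemma wcochain_admissible w q c I : wcochain w q c -> admissible hP w I (c I).
Proof. by move=> /(_ I); case: ifP => // _ -> j _; exact: holds_at0. Qed.

Lemma wcochain_eq0 w q c I : wcochain w q c -> #|I| != q -> c I = 0.
Proof. by move=> /(_ I) + /negPf Iq; rewrite Iq. Qed.

Lemma wcochain_set0 w q c : wcochain w q c -> c set0 = 0.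
Proof. by move=> /(_ set0); rewrite eqxx andbF. Qed.

(* These cochains compute the local cohomology at the point where all of the
   coordinates but x_i vanish, which is concentrated in degree m. *)
Lemma star_exact w i q c : wcochain w q.+1 c -> (forall I, i \notin I -> c I = 0) ->
    (forall I, delta c I = 0) ->
    (q < m)%N \/ (forall b : weight hP m,
      (forall a, w (lift i a) < (b : 'X_{1..m}) a) -> mdeg b != d) ->
  exists b, [/\ wcochain w q b, (forall I, i \notin I -> b I = 0) &
    forall I, c I = delta b I].
Proof.
move=> hc ci dc qm.
pose cb (b : weight hP m) I := wproj b (mxmap P (drop_mx k i) (c I)).
(* The weight b is contracted along an a with b a <= w. The value at I then comes from the larger
   set with [lift i a] added, but no regularity is lost: the condition at [lift i a] does not
   concern b. *)
pose bb (b : weight hP m) I :=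
  if [pick a | Posz ((b : 'X_{1..m}) a) <= w (lift i a)] is Some a
  then contract (lift i a) (cb b) I else 0.
pose e I := mxmap P (frame_mx k i) (\sum_b bb b I).
have cb0 b I : c I = 0 -> cb b I = 0 by rewrite /cb => ->; rewrite !linear0.
have ei I : i \notin I -> e I = 0.
  move=> iI; rewrite /e big1 ?linear0// => b _; rewrite /bb; case: pickP => // a _.
  rewrite /contract; case: ifP => // _; rewrite cb0 ?scaler0// ci// !inE.
  by rewrite (negPf iI) orbF (negPf (neq_lift _ _)).
exists e; split=> // [I|I].
  have [iI|iI] := boolP (i \in I); last first.
    rewrite ei//; case: ifP => // _ j _; exact: holds_at0.
  have -> : I != set0 by apply/set0Pn; exists i.
  rewrite andbT; case: eqP => [Iq|/eqP Iq]; last first.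
    rewrite /e big1 ?linear0// => b _; rewrite /bb; case: pickP => // a _.
    rewrite /contract; case: ifP => // /negbT aI.
    by rewrite cb0 ?scaler0// (wcochain_eq0 hc)// cardsU1 aI add1n eqSS.
  apply: (@admissible_at _ _ _ _ _ _ _ _ i) => //.
  split=> [|b a aI wb]; first by rewrite /balanced /e -mxmap_mul frame_drop_frame.
  rewrite /e -mxmap_mul frame_dropK mxmap1 linear_sum big1// => b' _; rewrite /bb.
  case: pickP => [a' ba'|_]; last by rewrite linear0.
  rewrite /contract; case: ifP => [_|/negbT a'I]; first by rewrite linear0.
  rewrite linearZ /= wprojK; case: eqP => [bb'|_]; last by rewrite scaler0.
  rewrite -bb' in ba' *; have [aa'|aa'] := eqVneq a a'.
    by move: wb; rewrite aa' ltNge ba'.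
  have [|_ H] := wcochain_admissible hc (I := lift i a' |: I) (j := i).
    by rewrite !inE iI orbT.
  by rewrite (H b a) ?scaler0// !inE (inj_eq lift_inj) (negPf aa').
have [iI|iI] := boolP (i \in I); last first.
  rewrite ci// /delta big1// => l lI; rewrite ei ?scaler0//.
  by rewrite !inE (negPf iI) andbF.
have [|ciB _] := wcochain_admissible hc (I := I) (j := i) => //.
rewrite -[LHS]ciB mxmap_mul.
transitivity (mxmap P (frame_mx k i) (delta (fun J => \sum_b bb b J) I)); last first.
  exact: delta_linear.
congr (mxmap _ _ _).
transitivity (\sum_(b : weight hP m) delta (bb b) I); last first.
  rewrite /delta exchange_big; apply: eq_bigr => l _ /=; by rewrite -scaler_sumr.
rewrite -[LHS](wproj_sum hP); apply: eq_bigr => b _; rewrite -/(cb b I).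
rewrite /bb; case: pickP => [a ba|nb].
  rewrite -[LHS](contractK (lift i a)) -[RHS]addr0; congr (_ + _).
  rewrite /contract; case: ifP => // _.
  have -> J : delta (cb b) J = 0.
    have := congr1 (fun p => wproj b (mxmap P (drop_mx k i) p)) (dc J).
    by rewrite /= (delta_linear (mxmap P (drop_mx k i))) linear_sum !linear0 => <-;
      apply: eq_bigr => l _; rewrite linearZ.
  by rewrite scaler0.
(* No direction is left to contract, and [cb b I] must vanish: either the degree of b is not d, or
   I, with q + 1 <= m elements, misses an index whose bound b exceeds. *)
rewrite /delta big1 => [|l _]; last by rewrite scaler0.
have {}nb a : w (lift i a) < Posz ((b : 'X_{1..m}) a).
  by rewrite ltNge nb.
have [qm'|/(_ b nb)] := qm; last by move=> bd; rewrite /cb wproj_deg ?zero_lfunE.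
have [Iq|Iq] := eqVneq #|I| q.+1; last by rewrite cb0// (wcochain_eq0 hc).
have [l lI] : exists l, l \notin I.
  apply/existsP; rewrite -negb_forall; apply: contraL qm' => /forallP IT.
  have {}IT : I = setT by apply/setP => l; rewrite IT inE.
  by rewrite IT cardsT card_ord in Iq; case: Iq => <-; rewrite ltnn.
have [a la|li] := unliftP i l; last by rewrite li iI in lI.
have [|_ H] := wcochain_admissible hc (I := I) (j := i) => //.
by rewrite /cb (H b a)// -la.
Qed.

End Exactness.

(** * Laurent expansions of regular functions *)

Lemma Posz_sum (I : Type) (s : seq I) (p : pred I) (F : I -> nat) :
  Posz (\sum_(i <- s | p i) F i)%N = \sum_(i <- s | p i) Posz (F i).
Proof. by rewrite -natz natr_sum; apply: eq_bigr => i _; rewrite natz. Qed.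

(** * Exactness of the subcomplexes of nonzero weight *)

Section NonzeroWeight.
Variables (k : closedFieldType) (P : polyFunctor k) (d : nat) (hP : of_degree d P).
Variable m : nat.
Implicit Types (w : expo m.+1) (I : {set 'I_m.+1}) (i j : 'I_m.+1).
Implicit Types (c : {set 'I_m.+1} -> P 'rV[k]_m.+1).

(** Each entry of b is at least w + 1 at its index, and the w at the m indices other than i add up
    to - w i. *)
Lemma degree_ge w i (b : weight hP m) : \sum_l w l = 0 ->
  (forall a, w (lift i a) < Posz ((b : 'X_{1..m}) a)) ->
  Posz m - w i <= Posz (mdeg b).
Proof.
rewrite (@bigD1_ord _ _ _ _ i)//= => w0 wb.
have -> : Posz m - w i = \sum_a (w (lift i a) + 1).
  rewrite big_split /= sumr_const card_ord natz addrC; congr (_ + _).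
  by apply/eqP; rewrite eq_sym -addr_eq0 addrC w0.
by rewrite mdegE Posz_sum; apply: ler_sum => a _; rewrite lezD1.
Qed.

Lemma drop_mx_inj w I p j : holds_at hP w I p j -> mxmap P (drop_mx k j) p = 0 -> p = 0.
Proof. by move=> [pj _] p0; rewrite -pj mxmap_mul p0 linear0. Qed.

Lemma nonzero_weight_exact w q c : w != 0 -> \sum_l w l = 0 ->
    wcochain hP w q.+1 c -> (forall I, delta c I = 0) ->
    (q < m)%N || (d <= m)%N ->
  exists2 b, wcochain hP w q b & forall I, c I = delta b I.
Proof.
move=> wn0 w0 hc dc qdm.
have [i wi] : exists i, w i < 0.
  apply/existsP; apply: contraNT wn0; rewrite negb_exists => /forallP wp.
  apply/eqP/ffunP => l; rewrite ffunE.
  have {}wp (j : 'I_m.+1) : 0 <= w j by rewrite leNgt.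
  by rewrite (psumr_eq0P _ w0).
have [I iI|||b [hb _ cb]] := @star_exact _ _ _ hP m w i q c hc.
(* For i outside of I, every weight b exceeds the bound at i, because w i < 0 <= b; so all weight
   components of c I vanish in the chart j. *)
- have [->|[j jI]] := set_0Vmem I; first exact: wcochain_set0 hc.
  have hj := wcochain_admissible hc jI; apply: (drop_mx_inj hj); rewrite -[LHS](wproj_sum hP).
  rewrite big1// => b _; have [a ia|ij] := unliftP j i; last by rewrite ij jI in iI.
  by apply: (hj.2 b a); rewrite -?ia //; exact: lt_le_trans wi _.
- exact: dc.
- case/orP: qdm => [|dm]; [by left|right => b /(degree_ge w0)]; apply: contraTneq => ->.
  by rewrite -ltNge; apply: (@le_lt_trans _ _ (Posz m)); rewrite ?lez_nat// ltrDl oppr_gt0.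
- by exists b.
Qed.

End NonzeroWeight.

(** * Laurent monomials on the intersections of charts *)

Section Regular.
Variables (k : closedFieldType) (n : nat).
Implicit Types (I J : {set 'I_n}) (a : expo n) (x : 'rV[k]_n).

Lemma in_chartS I J x : I \subset J -> in_chart J x -> in_chart I x.
Proof.
move=> /subsetP IJ /forall_inP xJ; apply/forall_inP => i /IJ; exact: xJ.
Qed.

Lemma regular_mono I a : \sum_l a l = 0 -> (forall l, l \notin I -> 0 <= a l) ->
  regular I (fun x => if in_chart I x then mono x a else 0).
Proof.
move=> a0 aI; split=> [x /negPf ->//|].
(* This e makes a l + e nonnegative for all l, so the e-th power of the product of the x_l, l in I,
   clears the denominators. *)
pose e := (\sum_l absz (a l))%N.
pose f l := if l \in I then absz (a l + Posz e) else absz (a l).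
have fE l : Posz (f l) = a l + (if l \in I then Posz e else 0).
  rewrite /f; case: ifP => [lI|/negbT/aI al]; last by rewrite addr0 gez0_abs.
  rewrite gez0_abs// /e (bigD1 l)//= PoszD addrA.
  apply: addr_ge0 => //; rewrite abszE; have := ler_norm (- a l).
  by rewrite normrN -subr_ge0 opprK addrC.
exists e, 'X_[[multinom f l | l < n]]; split=> [|x xI].
  rewrite dhomogX /= mdegE -eqz_nat Posz_sum.
  under eq_bigr do rewrite mnmE fE.
  by rewrite big_split /= a0 add0r -big_mkcond /= sumr_const -mulr_natr natz.
rewrite xI mevalX /mono -prodrXl [X in _ / X]big_mkcond -prodfV -big_split.
apply: eq_bigr => l _ /=; rewrite mnmE.
case: ifP => [lI|lI]; last by rewrite invr1 mulr1 [RHS]exprnP fE lI addr0.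
have xl : x 0 l != 0 by move/forall_inP: xI; apply.
by rewrite exprnP fE lI expfzDr// -exprnP mulfK// expf_neq0.
Qed.

(** Regularity is asked only of the terms with nonzero coefficient, since excluded weights
    contribute monomials with poles and coefficient zero. *)
Lemma regular_sum I (T : Type) (s : seq T) (c : T -> k) (f : T -> 'rV[k]_n -> k) :
  (forall i, c i = 0 \/ regular I (f i)) ->
  regular I (fun x => \sum_(i <- s) c i * f i x).
Proof.
move=> fI; elim: s => [|i s IH].
  have -> : (fun x => \sum_(i <- [::]) c i * f i x) = fun=> 0.
    by apply/funext => x; rewrite big_nil.
  exact: regular0.
have -> : (fun x => \sum_(j <- i :: s) c j * f j x) =
    fun x => c i * f i x + \sum_(j <- s) c j * f j x.
  by apply/funext => x; rewrite big_cons.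
have [-> |fi] := fI i; last exact: regularD.
by rewrite (_ : (fun x => _) = (fun x => \sum_(j <- s) c j * f j x))//;
  apply/funext => x; rewrite mul0r add0r.
Qed.

Definition section_expo I a := \sum_l a l = 0 /\ forall l, l \notin I -> 0 <= a l.

Lemma regular_expand I f : regular I f -> exists L : seq (expo n * k),
  (forall y, y \in L -> section_expo I y.1) /\
  forall x, in_chart I x -> f x = \sum_(y <- L) mono x y.1 * y.2.
Proof.
move=> [_ [e [F [hF fE]]]].
pose g (u : 'X_{1..n}) : expo n := [ffun l => Posz (u l) - (if l \in I then Posz e else 0)].
exists [seq (g u, F@_u) | u <- msupp F]; split=> [y /mapP[u uF ->]|x xI].
  split=> [|l lI] /=; last by rewrite ffunE (negPf lI) subr0.
  under eq_bigr do rewrite ffunE; rewrite big_split /= sumrN -big_mkcond sumr_const /=.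
  move/dhomogP: hF => /(_ u uF) /=; rewrite -Posz_sum -mdegE => ->.
  by rewrite -mulr_natr natz subrr.
rewrite fE// mevalE mulr_suml [RHS]big_map; apply: eq_bigr => u _ /=.
rewrite -mulrA mulrC; congr (_ * _).
rewrite -prodrXl [X in _ / X]big_mkcond -prodfV -big_split.
apply: eq_bigr => l _ /=; rewrite ffunE; case: ifP => [lI|lI].
  have xl : x 0 l != 0 by move/forall_inP: xI; apply.
  by rewrite expfzDr// -exprnN.
by rewrite invr1 mulr1 subr0.
Qed.

Lemma regular_vec_expand (W : vectType k) I (s : 'rV[k]_n -> W) : regular_vec I s ->
  exists L : seq (expo n * W),
  (forall y, y \in L -> section_expo I y.1) /\
  forall x, in_chart I x -> s x = \sum_(y <- L) mono x y.1 *: y.2.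
Proof.
move=> sI; pose B := vbasis {:W}.
have /choice[L LP] l : exists L : seq (expo n * k),
    (forall y, y \in L -> section_expo I y.1) /\
    forall x, in_chart I x -> coord B l (s x) = \sum_(y <- L) mono x y.1 * y.2.
  apply: regular_expand; have := sI (linfun (coord B l : W -> k^o)).
  by congr (regular I _); apply/funext => x; rewrite lfunE.
exists (flatten [seq [seq (y.1, y.2 *: B`_l) | y <- L l] | l : 'I_(\dim {:W}) <- enum 'I_(\dim {:W})]).
split=> [y /flattenP[_ /mapP[l _ ->] /mapP[z zL ->]]|x xI].
  exact: (LP l).1 _ zL.
rewrite big_flatten big_map big_enum /= [LHS](coord_vbasis (memvf _)).
apply: eq_bigr => l _; rewrite -/B (LP l).2// big_map scaler_suml.
by apply: eq_bigr => y _; rewrite scalerA.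
Qed.

Lemma regular_vec_eq0 (W : vectType k) I (s : 'rV[k]_n -> W) x :
  regular_vec I s -> ~~ in_chart I x -> s x = 0.
Proof.
move=> sI xI; rewrite [LHS](coord_vbasis (memvf _)) big1// => l _.
have := (sI (linfun (coord (vbasis {:W}) l : W -> k^o))).1 x xI.
by rewrite lfunE => ->; rewrite scale0r.
Qed.

End Regular.

(** * The sections of a given weight *)

Section WeightSections.
Variables (k : closedFieldType) (P : polyFunctor k) (d : nat) (hP : of_degree d P).
Variable m : nat.
Implicit Types (w : expo m.+1) (I : {set 'I_m.+1}) (i j : 'I_m.+1).
Implicit Types (p : P 'rV[k]_m.+1) (x : 'rV[k]_m.+1).

(* If p has weight b in the frame of the forms dz/z on U_j, then x^w p becomes
   x^(chart_expo j w b) p in the frame of the forms dz. *)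
Definition chart_expo j w (b : weight hP m) : expo m.+1 :=
  [ffun l => if unlift j l is Some a then w l - Posz ((b : 'X_{1..m}) a)
             else w l + Posz d].

(** Written weight by weight, the expression also makes sense where coordinates vanish and the
    factors of [chart_coords] are not defined. *)
Definition wsection j w p x : P 'rV[k]_m :=
  \sum_(b : weight hP m) mono x (chart_expo j w b) *: wproj b (mxmap P (drop_mx k j) p).

Lemma sum_lift (V : nmodType) j (F : 'I_m.+1 -> V) :
  \sum_l F l = F j + \sum_(a < m) F (lift j a).
Proof. by rewrite (@bigD1_ord _ _ _ _ j). Qed.

Lemma chart_expo_sum j w (b : weight hP m) : mdeg b = d ->
  \sum_l chart_expo j w b l = \sum_l w l.
Proof.
move=> bd; rewrite !(sum_lift j) ffunE unlift_none.
under eq_bigr do rewrite ffunE liftK.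
by rewrite sumrB -Posz_sum -mdegE bd addrACA -[X in _ + X]opprB subrr oppr0 addr0.
Qed.

(** The inverses 1/z of the affine coordinates z of U_j, the factors that express dz/z in terms of
    dz. *)
Definition chart_coords j x : 'rV[k]_m := \row_a (x 0 j / x 0 (lift j a)).

Lemma wsection_torus j w p x : torus x ->
  wsection j w p x =
    mono x w *: mxmap P (diag_mx (chart_coords j x)) (mxmap P (drop_mx k j) p).
Proof.
move=> xT; rewrite (mxmap_diag hP) scaler_sumr; apply: eq_bigr => b _.
have [bd|/wproj_deg ->] := eqVneq (mdeg b) d; last by rewrite zero_lfunE !scaler0.
rewrite scalerA; congr (_ *: _).
rewrite /mono !(@bigD1_ord _ _ _ _ j)//= ffunE unlift_none expfzDr//.
rewrite -!mulrA; congr (_ * _).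
have -> : x 0 j ^ Posz d = \prod_(a < m) x 0 j ^+ (b : 'X_{1..m}) a.
  by rewrite prodrXr -mdegE bd.
rewrite /nmono -!big_split.
apply: eq_bigr => a _ /=; rewrite ffunE liftK mxE expfzDr// -exprnN.
by rewrite exprMn exprVn mulrCA.
Qed.

(** Passing to the logarithmic frames turns the transition matrix of Omega into the constant matrix
    [frame_change]. *)
Lemma cotangent_torus i j x : torus x ->
  diag_mx (chart_coords i x) *m cotangent i j x =
    frame_change k i j *m diag_mx (chart_coords j x).
Proof.
move=> xT; apply/matrixP => a b; rewrite mul_diag_mx mul_mx_diag !mxE.
have [e|ne] := eqVneq (lift i a) (lift j b).
  have -> : (i == lift j b) = false by rewrite -e; exact/negbTE/neq_lift.
  by rewrite e !(mulr1n, mulr0n); field; rewrite !xT.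
have [e|_] := eqVneq i (lift j b); last by rewrite !mulr0n !mulr0 !mul0r subrr mul0r mulr0 mul0r.
by rewrite -e !(mulr1n, mulr0n); field; rewrite !xT.
Qed.

Lemma wsection_change_torus i j w p x : balanced p i -> torus x ->
  wsection j w p x = mxmap P (cotangent i j x) (wsection i w p x).
Proof.
move=> pi xT; rewrite !wsection_torus// linearZ /=; congr (_ *: _).
rewrite -[RHS]mxmap_mul cotangent_torus// mxmap_mul; congr (mxmap _ _ _).
by rewrite -frame_drop -[RHS]mxmap_mul mulmxA mxmap_mul pi.
Qed.

(* The line through x in the directions of its vanishing coordinates meets
   the complement of the torus only in x. *)
Definition line x (t : k) : 'rV[k]_m.+1 :=
  \row_l (if x 0 l == 0 then t else x 0 l).

Lemma line0 x : line x 0 = x.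
Proof. by apply/rowP => l; rewrite mxE; case: eqP. Qed.

Lemma line_torus x t : t != 0 -> torus (line x t).
Proof. by move=> t0 l; rewrite mxE; case: ifP => // ->. Qed.

Lemma lineE x t l : x 0 l != 0 -> line x t 0 l = x 0 l.
Proof. by rewrite mxE => /negPf ->. Qed.

Lemma polyfun_line x l : polyfun (fun t => line x t 0 l).
Proof.
have [x0|xn] := eqVneq (x 0 l) 0.
  by exists 'X => t; rewrite mxE x0 eqxx hornerX.
by exists (x 0 l)%:P => t; rewrite lineE// hornerC.
Qed.

Lemma polyfun_mono_line x (a : expo m.+1) : (forall l, x 0 l = 0 -> 0 <= a l) ->
  polyfun (fun t => mono (line x t) a).
Proof.
move=> a0; apply: polyfun_prod => l.
have [x0|xn] := eqVneq (x 0 l) 0.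
  have [q qE] := polyfunX (absz (a l)) (polyfun_line x l).
  by exists q => t; rewrite -qE exprnP gez0_abs// a0.
by exists (x 0 l ^ a l)%:P => t; rewrite lineE// hornerC.
Qed.

(** The exponent at [lift j a] is w - b; where it is negative outside of I, [holds_at] makes the
    coefficient zero. *)
Lemma chart_expo_ge0 w I p j (b : weight hP m) : holds_at hP w I p j ->
  wproj b (mxmap P (drop_mx k j) p) = 0 \/
    forall l, l \notin j |: I -> 0 <= chart_expo j w b l.
Proof.
move=> [_ H]; case: (eqVneq (wproj b (mxmap P (drop_mx k j) p)) 0); [by left|right] => l.
rewrite !inE negb_or => /andP[lj lI]; rewrite ffunE.
have [a la|lj'] := unliftP j l; last by rewrite lj' eqxx in lj.
rewrite subr_ge0 leNgt; apply: contraNN i => wb; apply/eqP.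
by apply: (H b a); rewrite -la.
Qed.

Lemma vpolyfun_wsection w I p j x : holds_at hP w I p j ->
  in_chart (j |: I) x -> vpolyfun (fun t => wsection j w p (line x t)).
Proof.
move=> hp xI; apply: vpolyfun_sum => b.
have [->|b0] := chart_expo_ge0 b hp.
  by exists [::] => t; rewrite scaler0 big_nil.
apply/vpolyfunZ/polyfun_mono_line => l xl; apply: b0.
by apply: contraTN xI => lI; apply/forall_inPn; exists l; rewrite ?xl ?eqxx.
Qed.

Lemma vpolyfun_cotangent i j x v : x 0 i != 0 -> x 0 j != 0 ->
  vpolyfun (fun t => mxmap P (cotangent i j (line x t)) v).
Proof.
move=> xi xj; apply: vpolyfun_mxmap => a b.
(* Along the line x_i and x_j stay constant, so the only varying factor of an entry is x_(lift i a),
   in the numerator. *)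
have [q qE] := polyfunM (polyfunD (polyfunC ((lift i a == lift j b)%:R * (x 0 i / x 0 j)))
  (polyfunM (polyfun_line x (lift i a)) (polyfunC (- (x 0 j)^-1 * (i == lift j b)%:R))))
  (polyfunC ((x 0 i / x 0 j) ^- 2)).
exists q => t; rewrite -qE mxE !(@lineE x t i)// !(@lineE x t j)//.
by congr (_ * _); congr (_ + _); rewrite mulNr mulrN mulrA.
Qed.

(** Both sides are polynomial along [line x] and agree on the torus, that is for t != 0; hence they
    agree at t = 0, which is x. *)
Lemma wsection_change w I p i j x : i \in I -> admissible hP w I p ->
  in_chart (j |: I) x ->
  wsection j w p x = mxmap P (cotangent i j x) (wsection i w p x).
Proof.
move=> iI hp xI; have hi := hp i iI; have hj := holds_at_change j iI hi.
have xiI : in_chart (i |: I) x.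
  by apply: in_chartS xI; rewrite (setUidPr _) ?sub1set// subsetUr.
have xi : x 0 i != 0 by move/forall_inP: xI; apply; rewrite !inE iI orbT.
have xj : x 0 j != 0 by move/forall_inP: xI; apply; rewrite !inE eqxx.
rewrite -{1 2 3}(line0 x); apply/subr0_eq.
pose f t := wsection j w p (line x t) -
  mxmap P (cotangent i j (line x t)) (wsection i w p (line x t)).
apply: (vpolyfun_vanish (f := f)); last first.
  move=> t t0; apply/eqP; rewrite subr_eq0; apply/eqP.
  by apply: wsection_change_torus; [case: hi|exact: line_torus].
apply: vpolyfun_sub; first exact: vpolyfun_wsection hj xI.
have [L LE] : vpolyfun (fun t => \sum_(b : weight hP m)
    mono (line x t) (chart_expo i w b) *:
      mxmap P (cotangent i j (line x t)) (wproj b (mxmap P (drop_mx k i) p))).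
  apply: vpolyfun_sum => b; have [->|b0] := chart_expo_ge0 b hi.
    by exists [::] => t; rewrite linear0 scaler0 big_nil.
  apply: vpolyfunZf; last exact: vpolyfun_cotangent.
  apply: polyfun_mono_line => l xl; apply: b0.
  by apply: contraTN xiI => lI; apply/forall_inPn; exists l; rewrite ?xl ?eqxx.
exists L => t; rewrite -LE linear_sum; apply: eq_bigr => b _; exact: linearZ.
Qed.

Definition wraw := {set 'I_m.+1} -> P 'rV[k]_m.+1.
HB.instance Definition _ := GRing.Lmodule.on wraw.

(* At a point of U_I outside of the torus, a weight b that is excluded by
   holds_at would give negative powers of zero; its coefficient is then zero. *)
Definition wcech w (c : wraw) : raw_cochain m.+1 P m.+1.-1 := fun I j x =>
  if in_chart (j |: I) x then wsection j w (c I) x else 0.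

Lemma wsection_linear j w x : linear (fun p => wsection j w p x).
Proof.
move=> a u v; rewrite /wsection scaler_sumr -big_split; apply: eq_bigr => b _ /=.
by rewrite linearP linearP /= scalerDr !scalerA mulrC.
Qed.

Lemma wcech_linear w : linear (wcech w).
Proof.
move=> a u v; apply/funext => I; apply/funext => j; apply/funext => x.
rewrite -[RHS]/(a *: wcech w u I j x + wcech w v I j x) /wcech.
case: ifP => _; last by rewrite scaler0 addr0.
exact: wsection_linear.
Qed.
HB.instance Definition _ w := GRing.isLinear.Build k wraw (raw_cochain m.+1 P m.+1.-1)
  _ (wcech w) (wcech_linear w).

Lemma cobound_wcech w c : cobound (wcech w c) = wcech w (delta c).
Proof.
apply/funext => I; apply/funext => j; apply/funext => x; rewrite /cobound {2}/wcech.
case: ifP => // xI; rewrite -[RHS]/((fun p => wsection j w p x) _).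
pose f := GRing.isLinear.Build k _ _ _ _ (wsection_linear j w x).
pose F : {linear P 'rV[k]_m.+1 -> P 'rV[k]_m} :=
  HB.pack (fun p => wsection j w p x) f.
rewrite -[RHS]/(F _) delta_linear; apply: eq_bigr => i iI; congr (_ *: _).
by rewrite /wcech (in_chartS _ xI)// setUS// subD1set.
Qed.

Lemma wsection0 j w x : wsection j w 0 x = 0.
Proof. by rewrite /wsection big1// => b _; rewrite !linear0. Qed.

Lemma wcech_is_section w I p : I != set0 -> \sum_l w l = 0 -> admissible hP w I p ->
  is_section (@cotangent k m.+1) I
    (fun j x => if in_chart (j |: I) x then wsection j w p x else 0 : P 'rV[k]_m).
Proof.
move=> /set0Pn[i iI] w0 hp; split=> [j l|j j' x xI].
  have hj := holds_at_change j iI (hp i iI).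
  have -> : (fun x => l (if in_chart (j |: I) x then wsection j w p x else 0)) =
      fun x => \sum_(b : weight hP m) l (wproj b (mxmap P (drop_mx k j) p)) *
        (if in_chart (j |: I) x then mono x (chart_expo j w b) else 0).
    apply/funext => x; case: ifP => _; last first.
      by rewrite linear0 big1// => b _; rewrite mulr0.
    by rewrite linear_sum; apply: eq_bigr => b _; rewrite linearZ mulrC.
  apply: regular_sum => b.
  have [bd|/wproj_deg ->] := eqVneq (mdeg b) d; last by left; rewrite zero_lfunE linear0.
  have [->|b0] := chart_expo_ge0 b hj; first by left; rewrite linear0.
  by right; apply: regular_mono; rewrite ?chart_expo_sum.
have xj : in_chart (j |: I) x by apply: in_chartS xI; rewrite setUS// subsetUr.
have xj' : in_chart (j' |: I) x by apply: in_chartS xI; rewrite subsetUr.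
rewrite xj xj'; have hj := holds_at_change j iI (hp i iI).
(* The source chart j has to belong to the index set. Adding j to I only removes conditions on p, so
   p remains admissible. *)
apply: (@wsection_change w (j |: I)); first exact: setU11.
  apply: (@admissible_at _ _ _ _ _ _ _ _ j); first exact: setU11.
  by split=> [|b a aI]; [case: hj|apply: hj.2; apply: contraNN aI => aI; rewrite !inE aI orbT].
by apply: in_chartS xI; rewrite setUCA.
Qed.

Lemma wcech_cochain w q c : \sum_l w l = 0 -> wcochain hP w q c ->
  cochain (@cotangent k m.+1) q (wcech w c).
Proof.
move=> w0 hc I; have := hc I; case: ifP => [/andP[_ I0]|_ c0].
  exact: wcech_is_section.
apply/funext => j; apply/funext => x; rewrite /wcech c0 wsection0; case: ifP => //.
Qed.

End WeightSections.

(** * The weight decomposition of cochains *)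

Section Decomposition.
Variables (k : closedFieldType) (P : polyFunctor k) (d : nat) (hP : of_degree d P).
Variable m : nat.
Implicit Types (w : expo m.+1) (I : {set 'I_m.+1}) (i j : 'I_m.+1).
Implicit Types (p : P 'rV[k]_m.+1) (x : 'rV[k]_m.+1) (c : wraw P m).

(** The component [s i], for one i in I, is expanded into monomials x^a and weights b. Each term
    comes from the exponent [wt a b], which inverts [chart_expo i], and the transition maps give the
    other components. *)
Lemma section_expand I s : I != set0 -> is_section (P := P) (@cotangent k m.+1) I s ->
  exists L : seq (expo m.+1 * P 'rV[k]_m.+1),
    (forall y, y \in L -> \sum_l y.1 l = 0 /\ admissible hP y.1 I y.2) /\
    forall j x, s j x =
      if in_chart (j |: I) x then \sum_(y <- L) wsection hP j y.1 y.2 x else 0.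
Proof.
move=> /set0Pn[i iI] [sreg strans].
have iIE : i |: I = I by apply/setUidPr; rewrite sub1set.
have [L0 [L0P L0E]] := regular_vec_expand (sreg i); rewrite iIE in L0P L0E.
pose wt (a : expo m.+1) (b : weight hP m) : expo m.+1 :=
  [ffun l => if unlift i l is Some c then a l + Posz ((b : 'X_{1..m}) c)
             else a l - Posz d].
have wtK a b : chart_expo i (wt a b) b = a.
  by apply/ffunP => l; rewrite !ffunE; case: unliftP => [c|] _; rewrite ?addrK ?subrK.
pose B := [seq b : weight hP m <- index_enum _ | mdeg (b : 'X_{1..m}) == d].
exists [seq (wt y.1 b, mxmap P (frame_mx k i) (wproj b y.2)) | y <- L0, b <- B].
set L := [seq _ | _ <- _, _ <- _].
have LP y : y \in L -> \sum_l y.1 l = 0 /\ admissible hP y.1 I y.2.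
  case/allpairsP => -[[a v] b] [/L0P[/= a0 aI] bB ->] /=.
  rewrite mem_filter in bB; case/andP: bB => /eqP bd _; split.
    by rewrite -(chart_expo_sum i _ bd) wtK.
  apply: (@admissible_at _ _ _ _ _ _ _ _ i) => //.
  split=> [|c e eI]; first by rewrite /balanced -mxmap_mul frame_drop_frame.
  rewrite -mxmap_mul frame_dropK mxmap1 wprojK ffunE liftK; case: eqP => // -> ae.
  by have := aI _ eI; rewrite leNgt -(ltrD2r (Posz ((b : 'X_{1..m}) e))) add0r ae.
have siE x : in_chart I x -> s i x = \sum_(y <- L) wsection hP i y.1 y.2 x.
  move=> xI; rewrite L0E// big_allpairs_dep; apply: eq_bigr => y _.
  rewrite -{1}(wproj_sum hP y.2) scaler_sumr big_filter [RHS]big_mkcond.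
  apply: eq_bigr => b _ /=; case: ifP => [_|/negbT bd]; last first.
    by rewrite wproj_deg// zero_lfunE scaler0.
  rewrite /wsection (bigD1 b)//= big1 ?addr0 => [|b' bb'].
    by rewrite -mxmap_mul frame_dropK mxmap1 wprojK eqxx wtK.
  by rewrite -mxmap_mul frame_dropK mxmap1 wprojK (negPf bb') scaler0.
split=> // j x; case: ifP => [xI|/negbT xI]; last exact: regular_vec_eq0 (sreg j) xI.
rewrite (strans i j) ?siE.
- rewrite linear_sum big_seq [RHS]big_seq; apply: eq_bigr => y /LP[_ yI];
    rewrite (wsection_change iI yI xI); reflexivity.
- by apply: in_chartS xI; exact: subsetUr.
- by rewrite setUCA iIE.
Qed.

Lemma wcochain_lin w q a c c' :
  wcochain hP w q c -> wcochain hP w q c' -> wcochain hP w q (a *: c + c').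
Proof.
move=> hc hc' I; have := hc I; have := hc' I.
case: ifP => _ H H'; last by rewrite -[LHS]/(a *: c I + c' I) H H' scaler0 addr0.
by move=> j jI; apply: holds_at_lin; [exact: H'|exact: H].
Qed.

Lemma wcochain0 w q : wcochain hP w q 0.
Proof. by move=> I; case: ifP => // _ j _; exact: holds_at0. Qed.

Lemma wcochain_sum w q (T : Type) (r : seq T) (Q : pred T) (F : T -> wraw P m) :
  (forall t, Q t -> wcochain hP w q (F t)) -> wcochain hP w q (\sum_(t <- r | Q t) F t).
Proof.
move=> H; apply: big_ind => //; first exact: wcochain0.
by move=> u v hu hv; rewrite -[u]scale1r; exact: wcochain_lin.
Qed.

(** The sections over all I are expanded and their terms grouped by weight. The weight 0 is always
    listed, so that the component of weight 0 can be referred to. *)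
Lemma cochain_expand q (c : raw_cochain m.+1 P m.+1.-1) : cochain (@cotangent k m.+1) q c ->
  exists (r : seq (expo m.+1)) (p : expo m.+1 -> wraw P m),
    [/\ uniq r, 0 \in r,
     forall w, w \in r -> \sum_l w l = 0 /\ wcochain hP w q (p w) &
     c = \sum_(w <- r) wcech hP w (p w)].
Proof.
move=> hc; have /choice[L LP] I : exists L : seq (expo m.+1 * P 'rV[k]_m.+1),
    (forall y, y \in L -> [/\ \sum_l y.1 l = 0, admissible hP y.1 I y.2,
       #|I| = q & I != set0]) /\
    forall j x, c I j x =
      if in_chart (j |: I) x then \sum_(y <- L) wsection hP j y.1 y.2 x else 0.
  have := hc I; case: ifP => [/andP[/eqP Iq I0] /(section_expand I0)[L [LP LE]]|_ c0].
    by exists L; split=> // y /LP[].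
  exists [::]; split=> // j x; rewrite c0 big_nil; by case: ifP.
pose single I p : wraw P m := fun J => if J == I then p else 0.
pose M : seq (expo m.+1 * wraw P m) :=
  flatten [seq [seq (y.1, single K y.2) | y <- L K] | K : {set 'I_m.+1} <- enum {set 'I_m.+1}].
have MP y : y \in M -> \sum_l y.1 l = 0 /\ wcochain hP y.1 q y.2.
  case/flattenP => _ /mapP[I _ ->] /mapP[z zL ->] /=.
  have [z0 zI Iq I0] := (LP I).1 _ zL; split=> // J; rewrite /single.
  by have [->|_] := eqVneq J I; [rewrite Iq eqxx I0|case: ifP => // _ j _; exact: holds_at0].
have ME : c = \sum_(y <- M) wcech hP y.1 y.2.
  rewrite big_flatten big_map big_enum /=.
  apply/funext => I; apply/funext => j; apply/funext => x.
  pose ev (c : raw_cochain m.+1 P m.+1.-1) : P 'rV[k]_m := c I j x.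
  have evD : {morph ev : u v / u + v} by [].
  have ev0 : ev 0 = 0 by [].
  rewrite -[RHS]/(ev _) (big_morph ev evD ev0) (bigD1 I)//= [X in _ + X]big1.
    rewrite addr0 big_map (big_morph ev evD ev0) (LP I).2 /ev /wcech /=.
    case: ifP => _; last by rewrite big1.
    by apply: eq_bigr => y _; rewrite /single eqxx.
  move=> J JI; rewrite big_map (big_morph ev evD ev0) big1// => y _.
  by rewrite /ev /wcech /= /single eq_sym (negPf JI) wsection0; case: ifP.
exists (undup (0 :: map fst M)), (fun w => \sum_(y <- M | y.1 == w) y.2); split.
- exact: undup_uniq.
- by rewrite mem_undup mem_head.
- move=> w; rewrite mem_undup => wM; split.
    move: wM; rewrite inE => /predU1P[->|/mapP[y /MP[+ _] ->]//].
    by rewrite big1// => l _; rewrite ffunE.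
  rewrite big_seq_cond; apply: wcochain_sum => y /andP[/MP[_ +] /eqP <-]; exact.
- rewrite {1}ME (@sum_fibers _ _ _ fst (undup (0 :: map fst M))).
  + apply: eq_bigr => w _; rewrite linear_sum; apply: eq_bigr => y /eqP <- //.
  + exact: undup_uniq.
  + by move=> w; rewrite mem_undup inE orbC => ->.
Qed.

(** What determines a cochain by its values on the torus. It involves neither weight nor degree, and
    so applies to coboundaries and differences. *)
Definition wbalanced c := c set0 = 0 /\ forall I j, j \in I -> balanced (c I) j.

Lemma wcochain_balanced w q c : wcochain hP w q c -> wbalanced c.
Proof.
move=> hc; split=> [|I j jI]; first exact: wcochain_set0 hc.
by case: (wcochain_admissible hc jI).
Qed.

Lemma delta_balanced c : wbalanced c -> wbalanced (delta c).
Proof.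
move=> [c0 cb]; split=> [|I j jI]; first by rewrite /delta big_set0.
rewrite /balanced linear_sum; apply: eq_bigr => i iI; rewrite linearZ /=.
congr (_ *: _); have [->|[l lI]] := set_0Vmem (I :\ i); first by rewrite c0 linear0.
exact: balanced_any (cb _ _ lI).
Qed.

(** On the torus, returning from the forms dz to dz/z leaves a Laurent polynomial in x whose
    coefficients are the images of the p w under [drop_mx]; balanced vectors are recovered from
    these. *)
Lemma wcech_free (r : seq (expo m.+1)) (p : expo m.+1 -> wraw P m) : uniq r ->
  (forall w, w \in r -> wbalanced (p w)) -> \sum_(w <- r) wcech hP w (p w) = 0 ->
  forall w, w \in r -> p w = 0.
Proof.
move=> ur pb E w wr; have [p0 pbw] := pb w wr.
apply/funext => I; have [->|[j jI]] := set_0Vmem I; first exact: p0.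
rewrite -[LHS](pbw I j jI) mxmap_mul.
suff -> : mxmap P (drop_mx k j) (p w I) = 0 by rewrite linear0.
have := @monomials_free k _ _ _ r id (fun w => mxmap P (drop_mx k j) (p w I)) _ w.
rewrite -big_filter (_ : [seq v <- r | v == w] = [:: w]) ?big_seq1; last first.
  by have := filter_pred1_uniq ur wr.
apply=> x xT; pose y : 'rV[k]_m := \row_a (x 0 (lift j a) / x 0 j).
have yK v : mxmap P (diag_mx y) (mxmap P (diag_mx (chart_coords j x)) v) = v.
  rewrite -mxmap_mul mulmx_diag (_ : \row__ _ = const_mx 1) ?diag_const_mx ?mxmap1//.
  by apply/rowP => a; rewrite !mxE mulrA divfK// divff.
transitivity (mxmap P (diag_mx y) ((\sum_(w <- r) wcech hP w (p w)) I j x)); last first.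
  by rewrite E linear0.
pose ev (c : raw_cochain m.+1 P m.+1.-1) : P 'rV[k]_m := c I j x.
rewrite -[X in mxmap _ _ X]/(ev _) (big_morph ev (id1 := 0) (op1 := +%R))//.
rewrite linear_sum; apply: eq_bigr => v _; rewrite /ev /wcech.
have -> : in_chart (j |: I) x by apply/forall_inP.
by rewrite wsection_torus// linearZ /= yK.
Qed.

End Decomposition.

(** * The part of weight zero *)

Section WeightZero.
Variables (k : closedFieldType) (P : polyFunctor k) (d : nat) (hP : of_degree d P).
Variable m : nat.
Implicit Types (c : wraw P m).

Lemma wdeltaD a (b c : wraw P m) : delta (a *: b + c) = a *: delta b + delta c :> wraw P m.
Proof.
apply/funext => I; rewrite -[RHS]/(a *: delta b I + delta c I) /delta.
rewrite scaler_sumr -big_split; apply: eq_bigr => i _ /=.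
by rewrite -[(_ + _) _]/(a *: b (I :\ i) + c (I :\ i)) scalerDr !scalerA mulrC.
Qed.

Lemma wdelta0 : delta (0 : wraw P m) = 0 :> wraw P m.
Proof. by have := wdeltaD (-1) 0 0; rewrite scaler0 addr0 scaleN1r addNr. Qed.

Lemma wdeltaB (b c : wraw P m) : delta (b - c) = delta b - delta c :> wraw P m.
Proof. by rewrite addrC -scaleN1r wdeltaD scaleN1r addrC. Qed.

(** A larger index set imposes fewer conditions, so the values on the faces of I are admissible for
    I; on the empty face the value is zero. *)
Lemma delta_wcochain w q c : wcochain hP w q c -> wcochain hP w q.+1 (delta c).
Proof.
move=> hc I; case: ifP => [/andP[/eqP Iq _]|/negbT Iq].
  move=> j jI; rewrite /delta; apply: (big_ind (fun p => holds_at hP w I p j)).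
  - exact: holds_at0.
  - by move=> u v hu hv; rewrite -[u]scale1r; exact: holds_at_lin.
  - move=> i iI; rewrite -[_ *: _]addr0; apply: holds_at_lin; last exact: holds_at0.
    have hl : holds_at hP w (I :\ i) (c (I :\ i)) j.
      have [->|[l lI]] := set_0Vmem (I :\ i).
        by rewrite (wcochain_set0 hc); exact: holds_at0.
      exact: holds_at_change lI (wcochain_admissible hc lI).
    case: hl => [hb hw]; split=> // b a aI; apply: hw.
    by apply: contra aI; rewrite !inE => /andP[].
rewrite /delta big1// => i iI; rewrite (wcochain_eq0 hc) ?scaler0//.
apply: contra Iq => /eqP Iq; have -> : I != set0 by apply/set0Pn; exists i.
by rewrite (cardsD1 i) iI Iq eqxx.
Qed.

Definition wcocycles q : {pred wraw P m} :=
  fun c => `[< wcochain hP 0 q.+1 c /\ delta c = 0 :> wraw P m >].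

Definition wcoboundaries q : {pred wraw P m} :=
  fun c => `[< exists2 b, wcochain hP 0 q b & c = delta b >].

Lemma wcocycles_closed q : GRing.subsemimod_closed (wcocycles q).
Proof.
apply: asbool_submod_closed => [|a b c [hb db] [hc dc]].
  by split; [exact: wcochain0|exact: wdelta0].
by split; [exact: wcochain_lin|rewrite wdeltaD db dc scaler0 addr0].
Qed.
HB.instance Definition _ q :=
  GRing.isSubmodClosed.Build k (wraw P m) (wcocycles q) (@wcocycles_closed q).

Lemma wcoboundaries_closed q : GRing.subsemimod_closed (wcoboundaries q).
Proof.
apply: asbool_submod_closed => [|a _ _ [b hb ->] [c hc ->]].
  by exists 0; [exact: wcochain0|rewrite wdelta0].
by exists (a *: b + c); [exact: wcochain_lin|rewrite wdeltaD].
Qed.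
HB.instance Definition _ q :=
  GRing.isSubmodClosed.Build k (wraw P m) (wcoboundaries q) (@wcoboundaries_closed q).

Definition wcohomology q : lmodType k := subquot (wcocycles q) (wcoboundaries q).

Lemma cobound_sum (T : Type) (r : seq T) (Q : pred T)
    (F : T -> raw_cochain m.+1 P m.+1.-1) :
  cobound (\sum_(t <- r | Q t) F t) = \sum_(t <- r | Q t) cobound (F t).
Proof.
apply: (big_morph (@cobound k m.+1 P m.+1.-1)) => [u v|]; last exact: cobound0.
by rewrite -[u]scale1r coboundD !scale1r.
Qed.

Lemma cochain_sum q (T : Type) (r : seq T) (Q : pred T)
    (F : T -> raw_cochain m.+1 P m.+1.-1) :
  (forall t, Q t -> cochain (@cotangent k m.+1) q (F t)) ->
  cochain (@cotangent k m.+1) q (\sum_(t <- r | Q t) F t).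
Proof.
move=> H; apply: big_ind => //; first exact: cochain0.
by move=> u v hu hv; rewrite -[u]scale1r; exact: cochainD.
Qed.

Lemma expo0_sum : \sum_l (0 : expo m.+1) l = 0.
Proof. by rewrite big1// => l _; rewrite ffunE. Qed.

Lemma wbalancedB (b c : wraw P m) : wbalanced b -> wbalanced c -> wbalanced (b - c).
Proof.
move=> [b0 bb] [c0 cb]; split=> [|I j jI].
  by rewrite -[LHS]/(b set0 - c set0) b0 c0 subrr.
rewrite /balanced -[(_ - _) I]/(b I - c I) linearB /=.
by rewrite (bb I j jI : mxmap _ _ _ = _) (cb I j jI : mxmap _ _ _ = _).
Qed.

(** The inclusion of C_0 induces the isomorphism: the weight 0 component of a bounding cochain still
    bounds, and the components of nonzero weight of a cocycle are coboundaries. *)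
Lemma HOmega_weight0 q : (q < m)%N || (d <= m)%N ->
  lmod_iso (wcohomology q) (HOmega P m.+1 q).
Proof.
move=> qdm; apply: (@subquot_iso _ _ _ _ _ _ _ (wcech hP 0)).
- move=> z /asboolP[zc zd]; apply/asboolP; split.
    by apply: wcech_cochain zc; exact: expo0_sum.
  by rewrite cobound_wcech zd linear0.
- move=> _ _ /asboolP[b hb ->]; apply/asboolP; exists (wcech hP 0 b).
    by apply: wcech_cochain hb; exact: expo0_sum.
  by rewrite cobound_wcech.
- move=> z /asboolP[zc zd] /asboolP[c /cochain_expand -/(_ _ hP)[r [p [ur r0 rp ->]]] E].
  (* [u w] is the weight w component of the relation E, brought to one side. *)
  pose u w : wraw P m := delta (p w) - (if w == 0 then z else 0).
  have : u 0 = 0.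
    apply: (@wcech_free _ _ _ hP m r u ur _ _ 0 r0) => [w wr|].
      apply: wbalancedB; first exact/delta_balanced/(wcochain_balanced (rp w wr).2).
      case: eqP => _; first exact: wcochain_balanced zc.
      by apply: (wcochain_balanced (wcochain0 hP 0 q)).
    under eq_bigr do rewrite /u linearB /= -cobound_wcech.
    rewrite sumrB -cobound_sum -E (bigD1_seq 0)//= eqxx big1 ?addr0 ?subrr//.
    by move=> w /negPf ->; rewrite linear0.
  rewrite /u eqxx => /subr0_eq zE; apply/asboolP; exists (p 0) => //.
  exact: (rp 0 r0).2.
- move=> z' /asboolP[/(cochain_expand hP)[r [p [ur r0 rp ->]]] dz].
  have dp w : w \in r -> delta (p w) = 0 :> wraw P m.
    move: w; apply: (@wcech_free _ _ _ hP m r (fun w => delta (p w)) ur) => [w wr|].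
      exact/delta_balanced/(wcochain_balanced (rp w wr).2).
    by rewrite -[RHS]dz cobound_sum; apply: eq_bigr => w _; rewrite cobound_wcech.
  have /choice[b bP] w : exists b : wraw P m, w \in r -> w != 0 ->
      wcochain hP w q b /\ p w = delta b.
    have [wr|] := boolP (w \in r); last by exists 0.
    have [w0|w0] := eqVneq w 0; first by exists 0.
    have [b hb pb] := nonzero_weight_exact w0 (rp w wr).1 (rp w wr).2
      (fun I => congr1 (fun c : wraw P m => c I) (dp w wr)) qdm.
    by exists b => _ _; split=> //; apply/funext.
  exists (p 0); first by apply/asboolP; split; [exact: (rp 0 r0).2|exact: dp].
  apply/asboolP; exists (\sum_(w <- r | (w \in r) && (w != 0)) wcech hP w (b w)).
    apply: cochain_sum => w /andP[wr w0].
    by apply: wcech_cochain; [exact: (rp w wr).1|exact: (bP w wr w0).1].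
  rewrite cobound_sum (bigD1_seq 0)//= addrAC subrr add0r big_seq_cond.
  by apply: eq_bigr => w /andP[wr w0]; rewrite cobound_wcech -(bP w wr w0).2.
Qed.

End WeightZero.

(** * Change of dimension *)

Section Support.
Variables (k : closedFieldType) (P : polyFunctor k) (d : nat) (hP : of_degree d P).
Variable m : nat.
Implicit Types (I : {set 'I_m.+1}) (i j : 'I_m.+1) (p : P 'rV[k]_m.+1).

(** For j in I, a projection onto Z_I: it erases the coordinates outside of I and then corrects the
    coordinate j to make the sum zero. *)
Definition support_mx I j : 'M[k]_m.+1 :=
  \matrix_(l', l) ((l' \in I)%:R * ((l == l')%:R - (l == j)%:R)).

Definition support_row I j : 'rV[k]_m := \row_a (lift j a \in I)%:R.

Lemma support_mx_diag I j : support_mx I j = drop_mx k j *m diag_mx (support_row I j) *m frame_mx k j.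
Proof.
apply/matrixP => l' l; rewrite mul_mx_diag !mxE.
have [a ->|->] := unliftP j l'.
  rewrite (bigD1 a)//= big1 => [|b ba].
    by rewrite !mxE eqxx mul1r addr0.
  by rewrite !mxE (inj_eq lift_inj) eq_sym (negPf ba) !mul0r.
rewrite subrr mulr0 big1// => a _.
by rewrite !mxE (negPf (neq_lift _ _)) !mul0r.
Qed.

(** For w = 0 the bounds leave exactly the weights supported on I, which are those fixed by the
    diagonal idempotent of I. For j in I, this says that p lies in P(Z_I). *)
Lemma holds_at0P I p j : holds_at hP 0 I p j <-> mxmap P (support_mx I j) p = p.
Proof.
split=> [[pj H]|pE].
  rewrite support_mx_diag 2!mxmap_mul -[RHS]pj mxmap_mul; congr (mxmap _ _ _).
  rewrite (mxmap_diag hP) -[RHS](wproj_sum hP); apply: eq_bigr => b _.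
  have [/existsP[a /andP[aI ba]]|nb] :=
      boolP [exists a, (lift j a \notin I) && (0 < (b : 'X_{1..m}) a)%N].
    by rewrite (H b a aI) ?scaler0// ffunE ltz_nat.
  rewrite /nmono big1 ?scale1r// => a _; rewrite mxE.
  move: nb; rewrite negb_exists => /forallP/(_ a); rewrite negb_and negbK -leqNgt leqn0.
  by case/orP => [-> | /eqP ->]; rewrite ?expr1n ?expr0.
have vE : mxmap P (drop_mx k j) p = mxmap P (diag_mx (support_row I j)) (mxmap P (drop_mx k j) p).
  by rewrite -{1}pE -mxmap_mul support_mx_diag -!mulmxA frame_dropK mulmx1 mxmap_mul.
split=> [|b a aI].
  by rewrite /balanced -{1}pE -mxmap_mul support_mx_diag -!mulmxA frame_drop_frame mulmxA -support_mx_diag.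
rewrite ffunE ltz_nat => ba; rewrite vE (mxmap_diag hP) linear_sum big1// => c _.
rewrite linearZ /= wprojK; case: eqP => [<-|_]; last by rewrite scaler0.
rewrite /nmono (bigD1 a)//= mxE (negPf aI) expr0n.
by rewrite eqn0Ngt ba mul0r scale0r.
Qed.

End Support.

(** * Omitting one homogeneous coordinate *)

Section Restriction.
Variables (k : closedFieldType) (P : polyFunctor k) (d : nat) (hP : of_degree d P).
Variables (m : nat) (i0 : 'I_m.+2).
Implicit Types (I : {set 'I_m.+1}) (J : {set 'I_m.+2}).

Let up I : {set 'I_m.+2} := [set lift i0 i | i in I].
Let down J : {set 'I_m.+1} := [set i | lift i0 i \in J].
(** Extension of row vectors by zero at i0. *)
Let incl_mx : 'M[k]_(m.+1, m.+2) := (drop_mx k i0)^T.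

Let upE I i : (lift i0 i \in up I) = (i \in I).
Proof. by rewrite mem_imset//; exact: lift_inj. Qed.

Let up0 I : i0 \notin up I.
Proof. by apply/imsetP => -[i _ /eqP]; rewrite (negPf (neq_lift _ _)). Qed.

Let upK I : down (up I) = I.
Proof. by apply/setP => i; rewrite inE upE. Qed.

Let downK J : i0 \notin J -> up (down J) = J.
Proof.
move=> iJ; apply/setP => l; have [i ->|->] := unliftP i0 l; first by rewrite upE inE.
by rewrite (negPf iJ) (negPf (up0 _)).
Qed.

Let card_up I : #|up I| = #|I|.
Proof. by rewrite card_imset//; exact: lift_inj. Qed.

Let up_eq0 I : (up I == set0) = (I == set0).
Proof. by rewrite -!cards_eq0 card_up. Qed.

Let upD1 I i : up I :\ lift i0 i = up (I :\ i).
Proof.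
apply/setP => l; have [j ->|->] := unliftP i0 l.
  by rewrite !inE !upE !inE (inj_eq lift_inj).
by rewrite !inE !(negPf (up0 _)) andbF.
Qed.

Let nbelow_up I i : nbelow (up I) (lift i0 i) = nbelow I i.
Proof.
rewrite /nbelow -(card_up [set l in I | (l < i)%N]); congr #|pred_of_set _|.
apply/setP => l; have [j ->|->] := unliftP i0 l.
  rewrite !inE !upE !inE; congr (_ && _).
  by rewrite !ltnNge leq_bump2.
by rewrite !inE !(negPf (up0 _)).
Qed.

Let support_mx_drop I j : support_mx k (up I) (lift i0 j) *m drop_mx k i0 = drop_mx k i0 *m support_mx k I j.
Proof.
apply/matrixP => l b; rewrite !mxE (bigD1 (lift i0 b))//= [X in _ + X = _]big1 => [|l' lb].
  rewrite !mxE eqxx mulr1 addr0 !(inj_eq lift_inj).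
  have [a ->|->] := unliftP i0 l.
    rewrite (bigD1 a)//= big1 => [|a' aa'].
      by rewrite !mxE eqxx mul1r addr0 upE !(inj_eq lift_inj).
    by rewrite !mxE (inj_eq lift_inj) eq_sym (negPf aa') mul0r.
  rewrite (negPf (up0 _)) mul0r big1// => a _.
  by rewrite !mxE (negPf (neq_lift _ _)) mul0r.
by rewrite !mxE (negPf lb) mulr0.
Qed.

Let incl_support_mx I j : incl_mx *m support_mx k (up I) (lift i0 j) = support_mx k I j *m incl_mx.
Proof.
apply/matrixP => a l; rewrite !mxE (bigD1 (lift i0 a))//= [X in _ + X = _]big1 => [|l' la].
  rewrite !mxE eqxx mul1r addr0 upE.
  have [b ->|->] := unliftP i0 l.
    rewrite (bigD1 b)//= big1 => [|b' bb'].
      by rewrite !mxE eqxx mulr1 addr0 !(inj_eq lift_inj).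
    by rewrite !mxE (inj_eq lift_inj) (eq_sym b) (negPf bb') mulr0.
  rewrite !(negPf (neq_lift _ _)) subrr mulr0 big1// => b _.
  by rewrite !mxE (negPf (neq_lift _ _)) mulr0.
by rewrite !mxE (negPf la) mul0r.
Qed.

Let incl_drop : incl_mx *m drop_mx k i0 = 1%:M.
Proof.
apply/matrixP => a b; rewrite !mxE (bigD1 (lift i0 a))//= [X in _ + X = _]big1 => [|l la].
  by rewrite !mxE eqxx mul1r addr0 (inj_eq lift_inj).
by rewrite !mxE (negPf la) mul0r.
Qed.

Let drop_incl_support_mx I j :
  drop_mx k i0 *m (incl_mx *m support_mx k (up I) (lift i0 j)) = support_mx k (up I) (lift i0 j).
Proof.
rewrite mulmxA; apply/matrixP => l' l; rewrite !mxE.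
have [a ->|->] := unliftP i0 l'.
  rewrite (bigD1 (lift i0 a))//= [X in _ + X = _]big1 => [|l'' la].
    rewrite !mxE (bigD1 a)//= big1 => [|b ba]; first by rewrite !mxE !eqxx mulr1 !addr0 mul1r.
    by rewrite !mxE (inj_eq lift_inj) eq_sym (negPf ba) mul0r.
  rewrite !mxE big1 ?mul0r// => b _; rewrite !mxE (inj_eq lift_inj).
  by case: eqP => [<-|_]; rewrite ?mul0r// (negPf la) mulr0.
rewrite (negPf (up0 _)) mul0r big1// => l'' _; rewrite !mxE big1 ?mul0r// => b _.
by rewrite !mxE (negPf (neq_lift _ _)) mul0r.
Qed.

Definition restrict (c : wraw P m.+1) : wraw P m := fun I => mxmap P (drop_mx k i0) (c (up I)).

(** A right inverse of [restrict] on cochains, which need not commute with [delta]. *)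
Definition extend (c : wraw P m) : wraw P m.+1 :=
  fun J => if i0 \in J then 0 else mxmap P incl_mx (c (down J)).

Lemma restrict_linear : linear restrict.
Proof. by move=> a u v; apply/funext => I; exact: linearP. Qed.
HB.instance Definition _ := GRing.isLinear.Build k (wraw P m.+1) (wraw P m)
  _ restrict restrict_linear.

Let extendK c : restrict (extend c) = c.
Proof.
by apply/funext => I; rewrite /restrict /extend (negPf (up0 _)) upK -mxmap_mul incl_drop mxmap1.
Qed.

Let restrict_delta c : restrict (delta c) = delta (restrict c).
Proof.
apply/funext => I; rewrite /restrict delta_linear big_imset/=; last first.
  by move=> i j _ _; exact: lift_inj.
by apply: eq_bigr => i _; rewrite nbelow_up upD1.
Qed.

Let restrict_wcochain q c : wcochain hP 0 q c -> wcochain hP 0 q (restrict c).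
Proof.
move=> hc I; have := hc (up I); rewrite card_up up_eq0 /restrict.
case: ifP => [_ H j jI|_ ->]; last exact: linear0.
have := H (lift i0 j); rewrite upE => /(_ jI)/holds_at0P E; apply/holds_at0P.
by rewrite -mxmap_mul -support_mx_drop mxmap_mul E.
Qed.

Let extend_wcochain q c : wcochain hP 0 q c -> wcochain hP 0 q (extend c).
Proof.
move=> hc J; rewrite /extend; have [iJ|iJ] := boolP (i0 \in J).
  by case: ifP => // _ j _; exact: holds_at0.
have := hc (down J); rewrite -card_up -up_eq0 downK//.
case: ifP => [_ H j jJ|_ ->]; last exact: linear0.
have [i ji|ji] := unliftP i0 j; last by rewrite ji (negPf iJ) in jJ.
have iI : i \in down J by rewrite inE -ji.
have /holds_at0P E := H i iI; apply/holds_at0P.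
by rewrite -mxmap_mul ji -{1}(downK iJ) incl_support_mx mxmap_mul E.
Qed.

(** For J without i0, the value c J lies in P(Z_J), where forgetting the coordinate i0 loses
    nothing. *)
Let restrict_eq0 q c : wcochain hP 0 q c -> restrict c = 0 ->
  forall J, i0 \notin J -> c J = 0.
Proof.
move=> hc c0 J iJ; have [->|[j jJ]] := set_0Vmem J; first exact: wcochain_set0 hc.
have /holds_at0P := wcochain_admissible hc jJ.
have [i ji|ji] := unliftP i0 j; last by rewrite ji (negPf iJ) in jJ.
rewrite ji -{1}(downK iJ) => <-; rewrite -drop_incl_support_mx mxmap_mul.
have := congr1 (fun c : wraw P m => c (down J)) c0; rewrite /restrict downK// => ->.
by rewrite -[(0 : wraw P m) _]/0 linear0.
Qed.

(** There are now m + 1 indices other than i0, so q <= m suffices, and a weight that cannot be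
    contracted has degree at least m + 1 > d. *)
Let star0_exact q c : (q <= m)%N || (d <= m)%N -> wcochain hP 0 q.+1 c ->
    (forall J, i0 \notin J -> c J = 0) -> delta c = 0 :> wraw P m.+1 ->
  exists b : wraw P m.+1, [/\ wcochain hP 0 q b, restrict b = 0 & c = delta b].
Proof.
move=> qdm hc c0 dc; have [||b [hb b0 cb]] := @star_exact _ _ _ hP m.+1 0 i0 q c hc c0.
- by move=> I; exact: (congr1 (fun c : wraw P m.+1 => c I) dc).
- case/orP: qdm => [qm|dm]; [by left|right => b /(degree_ge (expo0_sum _))].
  rewrite ffunE subr0 lez_nat; apply: contraTneq => ->.
  by rewrite -ltnNge.
- exists b; split=> //; last exact/funext.
  by apply/funext => I; rewrite /restrict b0 ?up0// linear0.
Qed.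

(** [restrict] is onto, and its kernel consists of the cochains on the star of i0. Its exactness in
    degrees q and q + 1 gives injectivity and surjectivity in cohomology. *)
Lemma restrict_iso q : (q < m)%N || (d <= m)%N ->
  lmod_iso (wcohomology hP m.+1 q) (wcohomology hP m q).
Proof.
move=> qdm; apply: (@subquot_iso _ _ _ _ _ _ _ restrict).
- move=> z /asboolP[hz dz]; apply/asboolP; split; first exact: restrict_wcochain.
  by rewrite -restrict_delta dz linear0.
- move=> _ _ /asboolP[b hb ->]; apply/asboolP; exists (restrict b).
    exact: restrict_wcochain.
  exact: restrict_delta.
- move=> z /asboolP[hz dz] /asboolP[b hb zb].
  (* z and [delta (extend b)] have the same restriction, so their difference is a cocycle in the
     kernel. *)
  have hz' : wcochain hP 0 q.+1 (z - delta (extend b)).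
    rewrite addrC -scaleN1r; apply: wcochain_lin hz.
    exact/delta_wcochain/extend_wcochain.
  have rz : restrict (z - delta (extend b)) = 0.
    by rewrite linearB /= restrict_delta extendK zb subrr.
  have [||b' [hb' _ zE]] := star0_exact _ hz' (restrict_eq0 hz' rz).
  + by case/orP: qdm => [/ltnW->//|->]; rewrite orbT.
  + rewrite wdeltaB dz sub0r; apply/eqP; rewrite oppr_eq0; apply/eqP/funext => J.
    exact: deltaK.
  apply/asboolP; exists (1 *: extend b + b').
    by apply: wcochain_lin => //; exact: extend_wcochain.
  by rewrite wdeltaD scale1r -zE addrC subrK.
- move=> z' /asboolP[hz' dz'].
  (* The failure of [extend z'] to be a cocycle lies in the kernel one degree higher, which is where
     q < m rather than q <= m is used. *)
  have hd := delta_wcochain (extend_wcochain hz').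
  have rd : restrict (delta (extend z')) = 0 by rewrite restrict_delta extendK.
  have [||b [hb rb bE]] := star0_exact _ hd (restrict_eq0 hd rd).
  + by case/orP: qdm => ->; rewrite ?orbT.
  + by apply/funext => J; exact: deltaK.
  exists (extend z' - b).
    apply/asboolP; split; last by rewrite wdeltaB bE subrr.
    rewrite addrC -scaleN1r; apply: wcochain_lin => //; exact: extend_wcochain.
  by rewrite linearB /= extendK rb subr0 subrr rpred0.
Qed.

End Restriction.

(** * Stability and vanishing of the cohomology of P(Omega) *)

Section Main.
Variables (k : closedFieldType) (P : polyFunctor k) (d : nat) (hP : of_degree d P).

Lemma wcohomology_stable q m m' : (m <= m')%N -> (q < m)%N || (d <= m)%N ->
  lmod_iso (wcohomology hP m' q) (wcohomology hP m q).
Proof.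
move=> mm' qdm; elim: m' mm' => [|m' IH].
  by rewrite leqn0 => /eqP ->; exact: lmod_iso_refl.
rewrite leq_eqVlt => /predU1P[->|]; first exact: lmod_iso_refl.
rewrite ltnS => mm'; apply: lmod_iso_trans (IH mm').
apply: (restrict_iso hP ord0); case/orP: qdm => qdm.
  by rewrite (leq_trans qdm mm').
by rewrite (leq_trans qdm mm') orbT.
Qed.

(** With n = m + 1, the alternative covers the ranges of (1) and (2) together; both sides are
    compared through C_0. *)
Lemma HOmega_stable q m m' : (q < m)%N || (d <= m)%N -> (q < m')%N || (d <= m')%N ->
  lmod_iso (HOmega P m.+1 q) (HOmega P m'.+1 q).
Proof.
wlog mm' : m m' / (m <= m')%N => [H|] hm hm'.
  have [/H|/ltnW/H E] := leqP m m'; first exact.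
  exact/lmod_iso_sym/E.
apply: lmod_iso_trans (lmod_iso_sym (HOmega_weight0 hP hm)) _.
apply: lmod_iso_trans _ (HOmega_weight0 hP hm').
exact/lmod_iso_sym/wcohomology_stable.
Qed.

(** A cochain of degree q lives on sets of q + 1 charts, and only m + 1 charts exist. *)
Lemma HOmega_gt m q : (m < q)%N -> forall h : HOmega P m.+1 q, h = 0.
Proof.
move=> mq; apply: subquot_eq0 => z /asboolP[hz _]; rewrite (_ : z = 0) ?rpred0//.
apply/funext => I; have := hz I; rewrite ifF//.
by rewrite ltn_eqF// (leq_ltn_trans (max_card _))// card_ord.
Qed.

Lemma HOmega_gt_degree m q : (d < q)%N -> forall h : HOmega P m.+1 q, h = 0.
Proof.
(* If d <= m, the group is that of m = d, where d + 1 charts leave no cochains of degree q > d; if m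
   < d, there are none already. *)
move=> dq; have [dm|md] := leqP d m; last exact: HOmega_gt (ltn_trans md dq).
have hm : (q < m)%N || (d <= m)%N by rewrite dm orbT.
have hd : (q < d)%N || (d <= d)%N by rewrite leqnn orbT.
have [f [g fK gK]] := HOmega_stable hm hd.
by move=> h; rewrite -(fK h) (HOmega_gt dq (f h)) -(HOmega_gt dq (f 0)) fK.
Qed.

End Main.

Theorem theorem4p2 (k : closedFieldType) (d : nat) (P : polyFunctor k)
    (hP : of_degree d P) :
  (forall j n m : nat, (0 < n)%N -> (0 < m)%N ->
     (j < n - 1)%N -> (j < m - 1)%N -> lmod_iso (HOmega P n j) (HOmega P m j)) /\
  (forall j n m : nat, (0 < n)%N -> (0 < m)%N ->
     (d <= n - 1)%N -> (d <= m - 1)%N -> lmod_iso (HOmega P n j) (HOmega P m j)) /\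
  (forall j n : nat, (0 < n)%N -> (d < j)%N ->
     forall h : HOmega P n j, h = 0%R).
Proof.
split; [|split].
- move=> j [//|n] [//|m] _ _; rewrite !subn1 => jn jm.
  by apply: (HOmega_stable hP); rewrite ?jn ?jm.
- move=> j [//|n] [//|m] _ _; rewrite !subn1 => dn dm.
  by apply: (HOmega_stable hP); rewrite ?dn ?dm orbT.
- move=> j [//|n] _; exact: (HOmega_gt_degree hP).
Qed.
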